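(* Let $\gamma=(\gamma_1,\gamma_2)\in \mathrm{PSL}_2(\mathbb{R})\times \mathrm{PSL}_2(\mathbb{R})$ be an isometry of the Anti-de Sitter space $\mathrm{AdS}$ given by a pair of hyperbolic elements. Then $$\ell_{Lor}(\gamma)=\frac{\ell_{\mathbb{H}}(\gamma_1)+\ell_{\mathbb{H}}(\gamma_2)}{2},$$ where $\ell_{Lor}(\gamma)$ is the Lorentzian translation length of $\gamma$ and $\ell_{\mathbb{H}}(\gamma_i)$ is the translation length of $\gamma_i$ acting on the hyperbolic plane $\mathbb{H}^2$.
   Context: $\mathrm{AdS}$ is $\mathrm{PSL}_2(\mathbb{R})$ endowed with the Lorentzian metric induced by the quadratic form $-\det$ on $M_2(\mathbb{R})$. An element $\gamma=(A,B)\in \mathrm{PSL}_2(\mathbb{R})\times \mathrm{PSL}_2(\mathbb{R})$ acts isometrically by $\gamma\cdot X=AXB^{-1}$. For $t\in\mathbb{R}$ write $D_t=\mathrm{diag}(e^t,e^{-t})$. The curve $t\mapsto D_t$ is a unit-speed spacelike geodesic of $\mathrm{AdS}$. The topological boundary of $\mathrm{AdS}$ is the set of projective classes of non-invertible nonzero matrices. If $\gamma=(\gamma_1,\gamma_2)$ is a pair of hyperbolic elements, it has an attracting fixed point $\gamma^+$ and a repelling fixed point $\gamma^-$ on this boundary, and the axis of $\gamma$ is the unique spacelike geodesic joining $\gamma^-$ to $\gamma^+$. Concretely, writing $\gamma_1=PD_\lambda P^{-1}$ and $\gamma_2=QD_{-\mu}Q^{-1}$ with $\lambda,\mu>0$ and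 $P,Q\in \mathrm{PSL}_2(\mathbb{R})$, the axis of $\gamma$ is $\{PD_tQ^{-1} : t\in\mathbb{R}\}$, with $\gamma^+=\lim_{t\to+\infty}PD_tQ^{-1}$ and $\gamma^-=\lim_{t\to-\infty}PD_tQ^{-1}$ in projective space. The isometry $\gamma$ preserves its axis and acts on it by translation. The Lorentzian translation length $\ell_{Lor}(\gamma)$ is the distance, for the induced metric on the axis of $\gamma$, between $o$ and $\gamma\cdot o$, for any point $o$ of the axis. The plane $\mathbb{H}^2$ has curvature $-1$, so the hyperbolic translation length of $D_\lambda$ is $2\lambda$ for $\lambda>0$. *)

(* Defs.v *)
From HB Require Import structures.
From mathcomp Require Import all_boot all_order all_algebra generic_quotient.
From mathcomp Require Import all_classical all_reals all_analysis.
From mathcomp Require Import complex.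
Import Order.TTheory GRing.Theory Num.Theory.
Import numFieldNormedType.Exports.

Set Implicit Arguments.
Unset Strict Implicit.
Unset Printing Implicit Defensive.

Local Open Scope classical_set_scope.
Local Open Scope ring_scope.
Local Open Scope quotient_scope.

Section PSL2.
Context {R : realType}.

Record SL2 := MkSL2 { sl_val :> 'M[R]_2 ; _ : \det sl_val == 1 }.

HB.instance Definition _ := [isSub for sl_val].
HB.instance Definition _ := [Choice of SL2 by <:].

Lemma sl_det (A : SL2) : \det A = 1.
Proof. exact/eqP/(valP A). Qed.

Lemma sl_unit (A : SL2) : (A : 'M[R]_2) \in unitmx.
Proof. by rewrite unitmxE sl_det unitr1. Qed.

Fact sl_one_subproof : \det (1%:M : 'M[R]_2) == 1.
Proof. by rewrite det1. Qed.

Fact sl_mul_subproof (A B : SL2) : \det (A *m B) == 1.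
Proof. by rewrite det_mulmx !sl_det mulr1. Qed.

Fact sl_inv_subproof (A : SL2) : \det (invmx A) == 1.
Proof. by rewrite det_inv sl_det invr1. Qed.

Definition sl_one : SL2 := MkSL2 sl_one_subproof.
Definition sl_mul (A B : SL2) : SL2 := MkSL2 (sl_mul_subproof A B).
Definition sl_inv (A : SL2) : SL2 := MkSL2 (sl_inv_subproof A).

Definition sl_sim (A B : SL2) : bool :=
  (sl_val A == sl_val B) || (sl_val A == - sl_val B).

Fact sl_sim_equiv : equiv_class_of sl_sim.
Proof.
split=> [A|A B|B A C]; rewrite /sl_sim.
- by rewrite eqxx.
- by rewrite [_ == sl_val A]eq_sym -eqr_oppLR [- sl_val A == _]eq_sym.
- by case/orP=> /eqP ->; case/orP=> /eqP ->; rewrite ?opprK eqxx ?orbT.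
Qed.

Canonical sl_sim_equivRel := EquivRelPack sl_sim_equiv.

Definition PSL2 := {eq_quot sl_sim}.
HB.instance Definition _ := Choice.on PSL2.
HB.instance Definition _ := EqQuotient.on PSL2.

Lemma psl_eqP (A B : SL2) :
  reflect (sl_val A = sl_val B \/ sl_val A = - sl_val B)
    (\pi_PSL2 A == \pi_PSL2 B).
Proof. by rewrite piE /= /sl_sim; apply: (iffP orP) => -[/eqP|/eqP]; auto. Qed.

Lemma psl_reprP (A : SL2) :
  sl_val (repr (\pi_PSL2 A)) = A \/ sl_val (repr (\pi_PSL2 A)) = - sl_val A.
Proof. by apply/psl_eqP; rewrite reprK. Qed.

Definition psl_one : PSL2 := \pi_PSL2 sl_one.
Definition psl_mul (x y : PSL2) : PSL2 := \pi_PSL2 (sl_mul (repr x) (repr y)).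
Definition psl_inv (x : PSL2) : PSL2 := \pi_PSL2 (sl_inv (repr x)).

Lemma pi_mul (A B : SL2) :
  psl_mul (\pi_PSL2 A) (\pi_PSL2 B) = \pi_PSL2 (sl_mul A B).
Proof.
apply/eqP/psl_eqP => /=.
by case: (psl_reprP A) => ->; case: (psl_reprP B) => ->;
  rewrite ?mulNmx ?mulmxN ?opprK; first [by left | by right].
Qed.

Lemma pi_inv (A : SL2) : psl_inv (\pi_PSL2 A) = \pi_PSL2 (sl_inv A).
Proof.
apply/eqP/psl_eqP => /=; case: (psl_reprP A) => ->; [by left|right].
rewrite -scaleN1r invmxZ ?scaleN1r ?invrN1 ?scaleN1r//.
by rewrite unitmxE -scaleN1r detZ sl_det mulr1 unitrX ?unitrN1.
Qed.

Fact psl_mulA : associative psl_mul.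
Proof.
elim/quotW=> A; elim/quotW=> B; elim/quotW=> C.
rewrite (pi_mul B C) (pi_mul A B) (pi_mul A) (pi_mul _ C).
by apply/eqP/psl_eqP; left; rewrite /= mulmxA.
Qed.

Fact psl_mul1 : left_id psl_one psl_mul.
Proof.
by elim/quotW=> A; rewrite pi_mul; apply/eqP/psl_eqP; left; rewrite /= mul1mx.
Qed.

Fact psl_mulr1 : right_id psl_one psl_mul.
Proof.
by elim/quotW=> A; rewrite pi_mul; apply/eqP/psl_eqP; left; rewrite /= mulmx1.
Qed.

Fact psl_mulV : left_inverse psl_one psl_inv psl_mul.
Proof.
elim/quotW=> A; rewrite pi_inv pi_mul; apply/eqP/psl_eqP; left.
by rewrite /= mulVmx ?sl_unit.
Qed.

Fact psl_mulrV : right_inverse psl_one psl_inv psl_mul.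
Proof.
elim/quotW=> A; rewrite pi_inv pi_mul; apply/eqP/psl_eqP; left.
by rewrite /= mulmxV ?sl_unit.
Qed.

HB.instance Definition _ :=
  isGroup.Build PSL2 psl_mulA psl_mul1 psl_mulr1 psl_mulV psl_mulrV.

(* Independent of the choice of representative, since |\tr (- A)| = |\tr A|. *)
Definition hyperbolic (g : PSL2) : Prop := `|\tr (repr g : 'M[R]_2)| > 2.

End PSL2.
Arguments SL2 R : clear implicits.
Arguments PSL2 R : clear implicits.

Section Hyperbolic_plane.
Context {R : realType}.

Definition upper_half_plane : set R[i] := [set z | 0 < complex.Im z].

Definition mobius (A : 'M[R]_2) (z : R[i]) : R[i] :=
  (real_complex R (A 0 0) * z + real_complex R (A 0 1)) /
  (real_complex R (A 1 0) * z + real_complex R (A 1 1)).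

(* Independent of the choice of representative: mobius (- A) = mobius A. *)
Definition hyp_act (g : PSL2 R) (z : R[i]) : R[i] :=
  mobius (repr g : 'M[R]_2) z.

Definition C1 {V : normedModType R} (f : R -> V) : Prop :=
  (forall t, derivable f t 1) /\ continuous (derive1 f).

Definition hyp_path (z w : R[i]) (c : R -> R[i]) : Prop :=
  [/\ C1 (fun t => complex.Re (c t)), C1 (fun t => complex.Im (c t)),
      (forall t, t \in `[0, 1] -> upper_half_plane (c t)),
      c 0 = z & c 1 = w].

(* Length for the metric (dx^2 + dy^2) / y^2, of curvature -1. *)
Definition hyp_length (c : R -> R[i]) : R :=
  \int[lebesgue_measure]_(t in `[0, 1])
    (Num.sqrt (derive1 (fun s => complex.Re (c s)) t ^+ 2 +
               derive1 (fun s => complex.Im (c s)) t ^+ 2) / complex.Im (c t)).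

Definition hyp_dist (z w : R[i]) : R := inf (hyp_length @` hyp_path z w).

Definition hyp_translation_length (g : PSL2 R) : R :=
  inf [set hyp_dist z (hyp_act g z) | z in upper_half_plane].

End Hyperbolic_plane.

Section AdS.
Context {R : realType}.

Definition AdS : Type := PSL2 R.

Definition ads_act (g : PSL2 R * PSL2 R) (x : AdS) : AdS :=
  (g.1 * (x : PSL2 R) * g.2^-1)%g.

(* The polar form of the quadratic form - \det. *)
Definition ads_form (V W : 'M[R]_2) : R :=
  - (\det (V + W) - \det V - \det W) / 2.

(* SL2 -> AdS being a covering, C^1 curves of AdS are the projections of
   C^1 curves of SL2, and the metric is computed on such a lift. *)
Definition velocity (c : R -> SL2 R) : R -> 'M[R]_2 :=
  derive1 (fun t => sl_val (c t)).

(* The tangent space of SL2 at X is the orthogonal of X in 'M[R]_2, so the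
   Levi-Civita derivative of the velocity vanishes iff the acceleration is
   orthogonal to it. *)
Definition geodesic (c : R -> SL2 R) : Prop :=
  [/\ forall t, derivable (fun s => sl_val (c s)) t 1,
      forall t, derivable (velocity c) t 1 &
      forall t V, ads_form (c t) V = 0 -> ads_form (derive1 (velocity c) t) V = 0].

Definition spacelike (c : R -> SL2 R) : Prop :=
  forall t, 0 < - \det (velocity c t).

Definition nzmx : set 'M[R]_2 := [set M | M != 0].

Definition proj_sim (M N : nzmx) : bool :=
  `[< exists2 k : R, k != 0 & set_val M = k *: set_val N >].

Fact proj_sim_equiv : equiv_class_of proj_sim.
Proof.
split=> [M|M N|N M L].
- by apply/asboolP; exists 1; rewrite ?oner_neq0 ?scale1r.
- apply/asboolP/asboolP => -[k k0 ->];
    by exists k^-1; rewrite ?invr_eq0 // scalerA mulVf ?scale1r.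
- move=> /asboolP[k k0 Mk] /asboolP[l l0 Nl]; apply/asboolP.
  by exists (k * l); rewrite ?mulf_neq0 // Mk Nl scalerA.
Qed.

Canonical proj_sim_equivRel := EquivRelPack proj_sim_equiv.

Definition proj := quotient_topology {eq_quot proj_sim}.
HB.instance Definition _ := Topological.on proj.
HB.instance Definition _ := Quotient.on proj.

Fact sl_nz (A : SL2 R) : sl_val A \in nzmx.
Proof.
apply/mem_set/eqP => A0; have /eqP := sl_det A.
by rewrite A0 det0 eq_sym oner_eq0.
Qed.

Definition sl_proj (A : SL2 R) : proj :=
  \pi_proj (exist (fun M => M \in nzmx) (sl_val A) (sl_nz A)).

Fact act_nz (A B : SL2 R) (M : nzmx) : A *m set_val M *m invmx B \in nzmx.
Proof.
apply/mem_set => /=; have: set_val M != 0 by exact: set_valP M.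
apply: contra_neq => /(congr1 (fun N => invmx A *m (N *m B))).
by rewrite mulmxKV ?sl_unit// mulKmx ?sl_unit// mul0mx mulmx0.
Qed.

Definition nz_act (A B : SL2 R) (M : nzmx) : nzmx :=
  exist (fun N => N \in nzmx) (A *m set_val M *m invmx B) (act_nz A B M).

(* Independent of the three choices of representatives. *)
Definition proj_act (g : PSL2 R * PSL2 R) (p : proj) : proj :=
  \pi_proj (nz_act (repr g.1) (repr g.2) (repr p)).

Definition boundary : set proj := [set p | \det (set_val (repr p)) = 0].

Definition attracting (g : PSL2 R * PSL2 R) (p : proj) : Prop :=
  [/\ boundary p, proj_act g p = p &
      \forall x \near p, boundary x -> iter n (proj_act g) x @[n --> \oo] --> p].

Definition repelling (g : PSL2 R * PSL2 R) (p : proj) : Prop :=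
  attracting (g.1^-1, g.2^-1)%g p.

Definition joins (c : R -> SL2 R) (p q : proj) : Prop :=
  sl_proj (c t) @[t --> -oo] --> p /\ sl_proj (c t) @[t --> +oo] --> q.

Definition is_axis (g : PSL2 R * PSL2 R) (L : set AdS) : Prop :=
  exists p q c, [/\ repelling g p, attracting g q,
    geodesic c /\ spacelike c, joins c p q &
    L = range (fun t => \pi_(PSL2 R) (c t))].

Definition axis (g : PSL2 R * PSL2 R) : set AdS := get (is_axis g).

Definition ads_path (L : set AdS) (x y : AdS) (c : R -> SL2 R) : Prop :=
  [/\ C1 (fun t => sl_val (c t)), (forall t, t \in `[0, 1] -> L (\pi_(PSL2 R) (c t))),
      \pi_(PSL2 R) (c 0) = x & \pi_(PSL2 R) (c 1) = y].

Definition ads_length (c : R -> SL2 R) : R :=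
  \int[lebesgue_measure]_(t in `[0, 1]) Num.sqrt (- \det (velocity c t)).

(* The distance of the metric induced on L (meaningful for L spacelike). *)
Definition induced_dist (L : set AdS) (x y : AdS) : R :=
  inf (ads_length @` ads_path L x y).

(* [get] returns 0 if no such l exists, in particular if the displacement
   depends on o; so a nonzero value is the common displacement. *)
Definition lorentz_translation_length (g : PSL2 R * PSL2 R) : R :=
  get [set l | axis g !=set0 /\
    forall o, axis g o -> induced_dist (axis g) o (ads_act g o) = l].

End AdS.

(* Main.v *)
Require Import Defs.
From mathcomp Require Import all_boot all_order all_algebra generic_quotient.
From mathcomp Require Import all_classical all_reals all_analysis.
From mathcomp Require Import complex ring lra.
Import Order.TTheory GRing.Theory Num.Theory.
Import numFieldNormedType.Exports.

Set Implicit Arguments.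
Unset Strict Implicit.
Unset Printing Implicit Defensive.

Local Open Scope classical_set_scope.
Local Open Scope ring_scope.
Local Open Scope quotient_scope.

(* Up to sign, g1 = P D_l P^-1 and g2 = Q D_(-m) Q^-1 with l, m > 0.  In the
   chart N = P^-1 X Q the isometry is N |-> D_l N D_m, which multiplies the
   (0,0) entry by the largest factor e^(l+m): the line of the matrix unit E00
   attracts every boundary point whose (0,0) entry is nonzero, and these are
   dense in the boundary, so N00^2 / |N|^2 = 1 at every attracting point.
   Conjugating by the rotation rot90, which exchanges E00 and E11, gives the
   repelling point.  A spacelike geodesic c satisfies c'' = k c with
   k = - det c' constant, hence c(t) = e^(st) U + e^(-st) W with s > 0; when it
   joins the two fixed points, U and W are multiples of E00 and E11, so that
   the axis is {P D_t Q^-1}, on which the isometry acts by t |-> t + l + m.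
   The infimum of lengths is bounded below by ln |N00|.
   On the hyperbolic plane, z |-> ln |P^-1 z| is 1-Lipschitz and is translated
   by 2l by g1, with equality along the curve P (i e^(2lt)). *)

(** * Calculus *)

(** [axis] and [lorentz_translation_length] are defined by [get], so exhibiting an axis is not
    enough: every set satisfying [is_axis] has to be identified, starting from fixed points that are
    only known to attract nearby boundary points. Limits in [proj] are compared through one
    continuous real function, [corner], so that uniqueness of limits is only invoked in [R]. The
    other obstacle is the choice of representatives: [repr] fixes a matrix only up to sign, whence
    the nonzero scalars carried through the statements and the squares inside logarithms. Both
    distances are infima over paths, bounded below by integrating a coordinate that grows at most at
    unit speed and that the isometry translates, and attained on an explicit path. The factor 1/2
    comes from the normalisations: D_t has unit speed in [AdS], whereas D_l sends i to i e^(2l), at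
    distance 2l. *)

Section Real_functions.
Context {R : realType}.
Implicit Types (f g F G : R -> R) (t : R).
Local Notation mu := (@lebesgue_measure R).

(** Rules in eta-expanded form: the derivative of an explicit formula is assembled by nesting them,
    then normalised with [is_derive_eq]. *)
Lemma is_deriveD_fun f g t df dg : is_derive t 1 f df -> is_derive t 1 g dg ->
  is_derive t 1 (fun s => f s + g s) (df + dg).
Proof. by move=> hf hg; exact: is_deriveD. Qed.

Lemma is_deriveB_fun f g t df dg : is_derive t 1 f df -> is_derive t 1 g dg ->
  is_derive t 1 (fun s => f s - g s) (df - dg).
Proof. by move=> hf hg; exact: is_deriveB. Qed.

Lemma is_deriveM_fun f g t df dg : is_derive t 1 f df -> is_derive t 1 g dg ->
  is_derive t 1 (fun s => f s * g s) (df * g t + f t * dg).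
Proof.
move=> hf hg; have h := is_deriveM hf hg; apply: (is_derive_eq h).
by rewrite /GRing.scale /= addrC [g t * df]mulrC.
Qed.

Lemma is_derive_ln_fun f t df : 0 < f t -> is_derive t 1 f df ->
  is_derive t 1 (fun s => ln (f s)) (df / f t).
Proof.
move=> f0 hf; have h := is_derive1_comp (is_derive1_ln f0) hf.
by apply: (is_derive_eq h); rewrite /GRing.scale /= mulrC.
Qed.

Lemma is_derive_expR_lin (k l t : R) :
  is_derive t 1 (fun s => expR (k * s + l)) (k * expR (k * t + l)).
Proof.
have hl : is_derive t 1 (fun s => k * s + l) (0 * t + k * 1 + 0).
  by apply: is_deriveD_fun; apply: is_deriveM_fun.
have h := @is_derive1_comp _ expR (fun s => k * s + l) t _ _
  (is_derive_expR (k * t + l)) hl.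
by apply: (is_derive_eq h); rewrite /GRing.scale /= mul0r add0r addr0 mulr1 mulrC.
Qed.

Lemma is_derive_continuous f t df : is_derive t 1 f df -> {for t, continuous f}.
Proof.
by move=> h; apply/differentiable_continuous/derivable1_diffP; exact: ex_derive.
Qed.

Lemma derivable_is_derive f t : derivable f t 1 -> is_derive t 1 f (derive1 f t).
Proof. by move=> df; rewrite derive1E; exact: DeriveDef. Qed.

Lemma for_continuous_within (A : set R) f :
  (forall t, A t -> {for t, continuous f}) -> {within A, continuous f}.
Proof.
by move=> h; apply: continuous_in_subspaceT => t /set_mem/h.
Qed.

(** The fundamental theorem of calculus followed by monotonicity of the integral. The comparison is
    asked on the open interval because a path constrained only on [0, 1] yields information on its
    derivative only at interior points. *)
Lemma le_Rintegral_deriv (F f G : R -> R) (a b : R) : a < b ->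
  (forall t, t \in `[a, b] -> is_derive t 1 F (f t)) ->
  (forall t, t \in `[a, b] -> {for t, continuous f}) ->
  (forall t, t \in `[a, b] -> {for t, continuous G}) ->
  (forall t, t \in `]a, b[ -> f t <= G t) ->
  F b - F a <= \int[mu]_(t in `[a, b]) G t.
Proof.
move=> ab dF cf cG fG.
have wf : {within `[a, b], continuous f} by exact: for_continuous_within.
have wG : {within `[a, b], continuous G} by exact: for_continuous_within.
have -> : F b - F a = \int[mu]_(t in `[a, b]) f t.
  rewrite /Rintegral (@continuous_FTC2 _ f F)//.
    split=> [t /subset_itv_oo_cc tab||].
    - by have := dF t tab => ?; exact: ex_derive.
    - apply: cvg_at_right_filter; apply: is_derive_continuous; apply: dF.
      by rewrite in_itv/= lexx ltW.
    - apply: cvg_at_left_filter; apply: is_derive_continuous; apply: dF.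
      by rewrite in_itv/= lexx ltW.
  move=> t /subset_itv_oo_cc tab; rewrite derive1E.
  by have := dF t tab => ?; rewrite derive_val.
have iclosed h : {within `[a, b], continuous h} -> mu.-integrable `[a, b] (EFin \o h).
  by move=> ch; apply: continuous_compact_integrable => //; exact: segment_compact.
have iopen h : {within `[a, b], continuous h} -> mu.-integrable `]a, b[ (EFin \o h).
  by move=> /iclosed; apply: integrableS => //; exact: subset_itv_oo_cc.
have ihalf h : {within `[a, b], continuous h} -> mu.-integrable `]a, b] (EFin \o h).
  by move=> /iclosed; apply: integrableS => //; exact: subset_itv_oc_cc.
(* The end points are null sets. *)
have openE h : {within `[a, b], continuous h} ->
    \int[mu]_(t in `[a, b]) h t = \int[mu]_(t in `]a, b[) h t.
  move=> ch; rewrite -Rintegral_itv_obnd_cbnd; last exact: ihalf.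
  by rewrite -Rintegral_itv_bndo_bndc//; exact: iopen.
rewrite !openE//; apply: le_Rintegral => //; exact: iopen.
Qed.

Lemma Rintegral01_cst (r : R) f : (forall t, t \in `[0, 1] -> f t = r) ->
  \int[mu]_(t in `[0, 1]) f t = r.
Proof.
move=> fr; rewrite (@eq_Rintegral _ _ _ mu _ (fun=> r)).
  by rewrite Rintegral_cst//= lebesgue_measure_itv/= lte01 sube0/= mulr1.
by move=> t /set_mem/fr.
Qed.

End Real_functions.

(** * Two by two matrices *)

Lemma ord2P (i : 'I_2) : i = 0 \/ i = 1.
Proof. by case: i => -[|[|//]] ?; [left|right]; exact: val_inj. Qed.

Section Matrix2.
Context {R : comPzRingType}.
Implicit Types A B : 'M[R]_2.

Lemma big_ord2 (V : nmodType) (F : 'I_2 -> V) : \sum_(i < 2) F i = F 0 + F 1.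
Proof.
rewrite !big_ord_recl big_ord0 addr0.
by congr (F _ + F _); exact: val_inj.
Qed.

Lemma mulmx2E A B i j : (A *m B) i j = A i 0 * B 0 j + A i 1 * B 1 j.
Proof. by rewrite mxE big_ord2. Qed.

Lemma matrix2P A B : A 0 0 = B 0 0 -> A 0 1 = B 0 1 -> A 1 0 = B 1 0 ->
  A 1 1 = B 1 1 -> A = B.
Proof.
move=> h00 h01 h10 h11; apply/matrixP => i j.
by case: (ord2P i) => ->; case: (ord2P j) => ->.
Qed.

End Matrix2.

Lemma det_mx2 (R : comNzRingType) (A : 'M[R]_2) :
  \det A = A 0 0 * A 1 1 - A 0 1 * A 1 0.
Proof.
rewrite (expand_det_row _ 0) big_ord2 /cofactor !det_mx11 !mxE /= expr0 mul1r.
have -> : lift 0 0 = 1 :> 'I_2 by exact: val_inj.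
have -> : lift 1 0 = 0 :> 'I_2 by exact: val_inj.
by rewrite expr1 mulN1r mulrN.
Qed.

(** * Moebius action and the logarithmic coordinate of a geodesic *)

Section Mobius.
Context {R : realType}.
Implicit Types (A B P : 'M[R]_2) (x y l t : R).

Definition Dmx t : 'M[R]_2 :=
  \matrix_(i, j) if i == j then expR (if i == 0 then t else - t) else 0.

Lemma Dmx00 t : Dmx t 0 0 = expR t. Proof. by rewrite mxE. Qed.
Lemma Dmx01 t : Dmx t 0 1 = 0. Proof. by rewrite mxE. Qed.
Lemma Dmx10 t : Dmx t 1 0 = 0. Proof. by rewrite mxE. Qed.
Lemma Dmx11 t : Dmx t 1 1 = expR (- t). Proof. by rewrite mxE. Qed.
Definition DmxE := (Dmx00, Dmx01, Dmx10, Dmx11).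

(** Numerator and denominator are multiplied by the conjugate of the denominator, whose squared
    modulus is [d]. *)
Lemma mobiusE A x y : let d := (A 1 0 * x + A 1 1) ^+ 2 + (A 1 0 * y) ^+ 2 in
  mobius A (Complex x y) =
  Complex (((A 0 0 * x + A 0 1) * (A 1 0 * x + A 1 1) +
            A 0 0 * A 1 0 * y ^+ 2) / d) (\det A * y / d).
Proof.
move=> d; set u := (X in _ = Complex X _); set v := (X in _ = Complex _ X).
rewrite /mobius /real_complex_def /GRing.mul /GRing.add /GRing.inv /=.
rewrite !mul0r !subr0 !addr0 -/d /u /v det_mx2.
by congr Complex; ring.
Qed.

Lemma mobiusZ (e : R) A z : e != 0 -> mobius (e *: A) z = mobius A z.
Proof.
move=> e0; have ec0 : real_complex R e != 0 by rewrite fmorph_eq0.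
by rewrite /mobius !mxE !rmorphM /= -!mulrA -!mulrDr invfM mulrACA divff ?mul1r.
Qed.

(* No condition on the denominator of [A]: if it vanishes, both sides are 0. *)
Lemma mobiusM A B z :
  real_complex R (B 1 0) * z + real_complex R (B 1 1) != 0 ->
  mobius A (mobius B z) = mobius (A *m B) z.
Proof.
move=> q0; rewrite /mobius !mulmx2E !rmorphD !rmorphM /=.
set p := real_complex R (B 0 0) * z + _.
set q := (X in X != 0) in q0 *.
have lin (a b : R[i]) : a * (p / q) + b = (a * p + b * q) / q.
  by field.
rewrite !lin invf_div mulrA divfK //.
by congr (_ / _); rewrite /p /q; ring.
Qed.

(** The imaginary part of the denominator is A10 * y, so if it vanishes the whole second row of [A]
    is zero. *)
Lemma mobius_denom_neq0 A x y : \det A != 0 -> 0 < y ->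
  real_complex R (A 1 0) * Complex x y + real_complex R (A 1 1) != 0.
Proof.
move=> dA y0; apply: contra_neq dA.
rewrite /real_complex_def /GRing.mul /GRing.add /= !mul0r subr0 !addr0.
move=> -[+ /eqP]; rewrite mulf_eq0 (gt_eqF y0) orbF => /[swap] /eqP c0.
by rewrite det_mx2 c0 mul0r add0r => ->; rewrite !mulr0 subr0.
Qed.

(** This is |a z + b|^2 for z = x + i y. *)
Definition sqden (a b x y : R) := (a * x + b) ^+ 2 + (a * y) ^+ 2.

Lemma sqden_gt0 (a b x y : R) : (a != 0) || (b != 0) -> 0 < y ->
  0 < sqden a b x y.
Proof.
move=> ab0 y0; rewrite /sqden.
have [a0|a0] := eqVneq a 0.
  move: ab0; rewrite a0 eqxx /= => b0.
  by rewrite !mul0r add0r expr0n addr0 exprn_even_gt0.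
rewrite ltr_wpDl ?sqr_ge0// exprn_even_gt0//= mulf_neq0//.
by rewrite gt_eqF.
Qed.

Lemma det1_row_neq0 A : \det A = 1 ->
  ((A 0 0 != 0) || (A 0 1 != 0)) /\ ((A 1 0 != 0) || (A 1 1 != 0)).
Proof.
rewrite det_mx2 => dA; split; apply: contraT; rewrite negb_or !negbK.
  move=> /andP[/eqP a0 /eqP b0]; move: dA.
  by rewrite a0 b0 !mul0r subr0 => /esym/eqP; rewrite oner_eq0.
move=> /andP[/eqP a0 /eqP b0]; move: dA.
by rewrite a0 b0 !mulr0 subr0 => /esym/eqP; rewrite oner_eq0.
Qed.

(* ln |P z|, the coordinate along the axis from P^-1 0 to P^-1 oo. *)
Definition axis_coord P x y : R :=
  (ln (sqden (P 0 0) (P 0 1) x y) - ln (sqden (P 1 0) (P 1 1) x y)) / 2.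

(* |d ln (P z)| = |dz| / |(az + b)(cz + d)| and
   |(az + b)(cz + d)| >= |Im ((az + b) conj(cz + d))| = Im z. *)
Lemma axis_coord_1lipschitz (a b c d x y x' y' : R) : 0 < y ->
  a * d - b * c = 1 -> 0 < sqden a b x y -> 0 < sqden c d x y ->
  ((2 * (a * x + b) * (a * x') + 2 * (a * y) * (a * y')) / sqden a b x y -
   (2 * (c * x + d) * (c * x') + 2 * (c * y) * (c * y')) / sqden c d x y) / 2
  <= Num.sqrt (x' ^+ 2 + y' ^+ 2) / y.
Proof.
move=> y0 det1; set M := sqden a b x y; set N := sqden c d x y => M0 N0.
rewrite ler_pdivlMr//.
apply: (le_trans (ler_norm _)); rewrite -sqrtr_sqr; apply: ler_wsqrtr.
(* The gradient of ln |P z| is (p, q) / (M N), of squared norm 1 / (M N) by [pq]. *)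
pose p := a * (a * x + b) * N - c * (c * x + d) * M.
pose q := y * (a ^+ 2 * N - c ^+ 2 * M).
have pq : p ^+ 2 + q ^+ 2 = M * N.
  (* Inserting a power of the determinant, equal to 1, makes this a polynomial identity. *)
  transitivity (M * N * (a * d - b * c) ^+ 2); last by rewrite det1 expr1n mulr1.
  by rewrite /p /q /M /N /sqden; ring.
have MN : y ^+ 2 <= M * N.
  rewrite -subr_ge0.
  (* The right-hand side is the squared real part of (a z + b) conj(c z + d), whose imaginary part
     is y up to the determinant. *)
  have -> : M * N - y ^+ 2 =
      ((a * x + b) * (c * x + d) + a * c * y ^+ 2) ^+ 2.
    transitivity (M * N - (a * d - b * c) ^+ 2 * y ^+ 2).
      by rewrite det1 expr1n mul1r.
    by rewrite /M /N /sqden; ring.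
  exact: sqr_ge0.
have -> : (((2 * (a * x + b) * (a * x') + 2 * (a * y) * (a * y')) / M -
   (2 * (c * x + d) * (c * x') + 2 * (c * y) * (c * y')) / N) / 2 * y) =
   (p * x' + q * y') * y / (M * N).
  by rewrite /p /q; field; rewrite !gt_eqF.
rewrite expr_div_n ler_pdivrMr ?exprn_gt0 ?mulr_gt0//.
rewrite exprMn.
have CS : (p * x' + q * y') ^+ 2 <= M * N * (x' ^+ 2 + y' ^+ 2).
  rewrite -pq -subr_ge0.
  have -> : (p ^+ 2 + q ^+ 2) * (x' ^+ 2 + y' ^+ 2) - (p * x' + q * y') ^+ 2 =
    (p * y' - q * x') ^+ 2 by ring.
  exact: sqr_ge0.
apply: (le_trans (ler_pM (sqr_ge0 _) (sqr_ge0 _) CS MN)).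
by rewrite le_eqVlt; apply/orP; left; apply/eqP; ring.
Qed.

End Mobius.

(** * Normal form of hyperbolic elements *)

Section Diagonalization.
Context {R : realType}.
Implicit Types (A P Q M : 'M[R]_2) (l m t : R) (g : PSL2 R).

Definition mx2 (a b c d : R) : 'M[R]_2 :=
  \matrix_(i, j) if i == 0 then (if j == 0 then a else b)
                 else (if j == 0 then c else d).

Lemma mx2_00 a b c d : mx2 a b c d 0 0 = a. Proof. by rewrite mxE. Qed.
Lemma mx2_01 a b c d : mx2 a b c d 0 1 = b. Proof. by rewrite mxE. Qed.
Lemma mx2_10 a b c d : mx2 a b c d 1 0 = c. Proof. by rewrite mxE. Qed.
Lemma mx2_11 a b c d : mx2 a b c d 1 1 = d. Proof. by rewrite mxE. Qed.
Definition mx2E := (mx2_00, mx2_01, mx2_10, mx2_11).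

Lemma scalemx2E (e : R) A i j : (e *: A) i j = e * A i j.
Proof. by rewrite mxE. Qed.

Definition rot90 : 'M[R]_2 := mx2 0 (-1) 1 0.

Lemma det_rot90 : \det rot90 = 1.
Proof. by rewrite det_mx2 !mx2E; ring. Qed.

Lemma Dmx_rot90 t : Dmx t *m rot90 = rot90 *m Dmx (- t).
Proof. by apply: matrix2P; rewrite !mulmx2E !mx2E !DmxE ?opprK; ring. Qed.

Lemma DmxD s t : Dmx (s + t) = Dmx s *m Dmx t :> 'M[R]_2.
Proof.
by apply: matrix2P; rewrite !mulmx2E !DmxE ?opprD ?expRD; ring.
Qed.

Lemma det_Dmx t : \det (Dmx t) = 1.
Proof.
by rewrite det_mx2 !DmxE mul0r subr0 -expRD subrr expR0.
Qed.

Lemma Dmx0 : Dmx 0 = 1%:M :> 'M[R]_2.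
Proof. by apply: matrix2P; rewrite !DmxE !mxE ?oppr0 ?expR0. Qed.

(** Determinants force e^2 = 1; stating only [e != 0] lets scalars be composed without tracking
    signs. The exponent [l] may be negative, so that inverses and exchanged eigenlines are covered
    by the same predicate. *)
Definition diagonalizes g P l := \det P = 1 /\
  exists2 e, e != 0 & sl_val (repr g) *m P = e *: (P *m Dmx l).

Lemma unitmx_det1 A : \det A = 1 -> A \in unitmx.
Proof. by move=> dA; rewrite unitmxE dA unitr1. Qed.

(** The quarter turn exchanges the two eigenlines. It gives the second isometry the exponent [- m]
    and, combined with [diagonalizes_inv], restores the exponents for the inverse pair, so that
    repelling points are handled as attracting ones. *)
Lemma diagonalizes_rot90 g P l :
  diagonalizes g P l -> diagonalizes g (P *m rot90) (- l).
Proof.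
move=> [dP [e e0 AP]]; split; first by rewrite det_mulmx dP det_rot90 mulr1.
by exists e => //; rewrite mulmxA AP -scalemxAl -!mulmxA -Dmx_rot90.
Qed.

(** The representative chosen for the inverse class may differ by a sign from the inverse of the
    chosen representative. *)
Lemma repr_invg g : exists2 e : R, e != 0 &
  sl_val (repr (g^-1)%g) = e *: invmx (sl_val (repr g)).
Proof.
rewrite -[(g^-1)%g]/(psl_inv g) /psl_inv.
case: (psl_reprP (sl_inv (repr g))) => -> /=.
  by exists 1; rewrite ?oner_neq0 ?scale1r.
by exists (-1); rewrite ?oppr_eq0 ?oner_neq0 ?scaleN1r.
Qed.

Lemma diagonalizes_inv g P l :
  diagonalizes g P l -> diagonalizes (g^-1)%g P (- l).
Proof.
move=> [dP [e e0 AP]]; split=> //; have [k k0 ->] := repr_invg g.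
exists (k / e); first by rewrite mulf_neq0 ?invr_eq0.
have uA := sl_unit (repr g).
rewrite -scalemxAl -scalerA; congr (_ *: _).
apply: (can_inj (mulKmx uA)); rewrite mulKVmx//.
rewrite -scalemxAr mulmxA AP -scalemxAl scalerA mulVf// scale1r.
by rewrite -mulmxA -DmxD subrr Dmx0 mulmx1.
Qed.

(** Trace and determinant give the eigenvalues r and 1/r, which are distinct since r > 1; the
    columns of [P] are eigenvectors, scaled to make its determinant 1. *)
Lemma diag_of_trace A (r : R) : 1 < r -> \det A = 1 -> \tr A = r + r^-1 ->
  exists2 P, \det P = 1 & A *m P = P *m mx2 r 0 0 r^-1.
Proof.
move=> r1 dA trA; have r0 : r != 0 by rewrite gt_eqF// (lt_trans ltr01).
have rr : r - r^-1 != 0.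
  rewrite gt_eqF// subr_gt0 (@lt_trans _ _ 1)// invf_lt1// (lt_trans ltr01)//.
have r2 : r * r - 1 != 0.
  have E : r - r^-1 = (r * r - 1) / r by field.
  by apply: contra_neq rr => rr; rewrite E rr mul0r.
have Ad : A 1 1 = r + r^-1 - A 0 0.
  by rewrite -trA /mxtrace big_ord2 addrAC subrr add0r.
have bc : A 0 1 * A 1 0 = A 0 0 * A 1 1 - 1.
  by rewrite -dA det_mx2 opprB addrC subrK.
have [c0|c0] := eqVneq (A 1 0) 0; last first.
  have Ab : A 0 1 = (A 0 0 * (r + r^-1 - A 0 0) - 1) / A 1 0.
    by rewrite -Ad -bc mulfK.
  (* The eigenvectors for r and 1/r are (r - A11, A10) and (1/r - A11, A10); the second is divided
     by their determinant A10 (r - 1/r). *)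
  exists (mx2 (r - A 1 1) ((r^-1 - A 1 1) / (A 1 0 * (r - r^-1)))
          (A 1 0) (r - r^-1)^-1).
    by rewrite det_mx2 !mx2E; field; rewrite r0 c0 r2.
  apply: matrix2P; rewrite !mulmx2E !mx2E ?Ab ?Ad; field;
    by rewrite ?r0 ?c0 ?r2.
(* Here [A] is upper triangular, and its diagonal lists the eigenvalues in either order. *)
have [Aa|Aa] : A 0 0 = r \/ A 0 0 = r^-1.
  have : (A 0 0 - r) * (A 0 0 - r^-1) = 0.
    transitivity (1 - (A 0 0 * (r + r^-1 - A 0 0))); first by field.
    by rewrite -Ad -opprB -bc c0 mulr0 oppr0.
  by move/eqP; rewrite mulf_eq0 !subr_eq0 => /orP[]/eqP; [left|right].
- exists (mx2 1 (- (A 0 1 / (r - r^-1))) 0 1).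
    by rewrite det_mx2 !mx2E; ring.
  apply: matrix2P; rewrite !mulmx2E !mx2E ?Ad ?Aa ?c0; field;
    by rewrite ?r0 ?r2.
- exists (mx2 (A 0 1) (- (r - r^-1)^-1) (r - r^-1) 0).
    by rewrite det_mx2 !mx2E; field; rewrite r0 r2.
  apply: matrix2P; rewrite !mulmx2E !mx2E ?Ad ?Aa ?c0; field;
    by rewrite ?r0 ?r2.
Qed.

(** Multiplying by the sign [e] of the trace makes the trace exceed 2. Then [r] is the larger root
    of X^2 - |tau| X + 1, and l = ln r. *)
Lemma hyperbolic_diagonalizes g : hyperbolic g ->
  exists P l, 0 < l /\ diagonalizes g P l.
Proof.
rewrite /hyperbolic; set A := sl_val (repr g); set tau := \tr A => htau.
pose e : R := Num.sg tau.
have tau0 : tau != 0 by rewrite -normr_eq0 gt_eqF// (lt_trans _ htau).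
have e2 : e * e = 1 by rewrite -expr2 sqr_sg tau0.
have etau : e * tau = `|tau| by rewrite normrEsg.
pose q := Num.sqrt (tau ^+ 2 - 4).
have q2 : q ^+ 2 = tau ^+ 2 - 4.
  rewrite sqr_sqrtr// subr_ge0 -[tau ^+ 2]real_normK ?num_real//.
  have -> : 4 = 2 ^+ 2 :> R by ring.
  by rewrite ler_pXn2r ?nnegrE// ltW.
pose r := (`|tau| + q) / 2.
have q0 : 0 <= q by exact: sqrtr_ge0.
have r1 : 1 < r by rewrite /r; lra.
have r0 : r != 0 by rewrite gt_eqF// (lt_trans ltr01).
have rtau : `|tau| = r + r^-1.
  apply: (mulIf r0); rewrite mulrDl mulVf// /r.
  have t2 : `|tau| ^+ 2 = tau ^+ 2 by rewrite real_normK ?num_real.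
  nra.
have [||P dP AP] := @diag_of_trace (e *: A) r r1.
- by rewrite detZ expr2 e2 mul1r sl_det.
- by rewrite mxtraceZ etau.
exists P, (ln r); split; first exact: ln_gt0.
split=> //; exists e.
  by apply: contra_eq_neq e2 => ->; rewrite mul0r eq_sym oner_neq0.
rewrite -/A -[A]scale1r -e2 -scalerA -scalemxAl AP; congr (_ *: (_ *m _)).
apply: matrix2P; rewrite !mx2E !DmxE// ?expRN lnK// posrE (lt_trans ltr01)//.
Qed.

End Diagonalization.

(** * Translation length on the hyperbolic plane *)

Section Hyperbolic_length.
Context {R : realType}.
Implicit Types (A B P : 'M[R]_2) (x y l t : R).

Lemma continuous_sqr (f : R -> R) t :
  {for t, continuous f} -> {for t, continuous (fun s => f s ^+ 2)}.
Proof. by move=> cf; exact: continuousM. Qed.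

Lemma continuous_sqden (a b : R) (x y : R -> R) t :
  {for t, continuous x} -> {for t, continuous y} ->
  {for t, continuous (fun s => sqden a b (x s) (y s))}.
Proof.
move=> cx cy; rewrite /sqden; apply: continuousD; apply: continuous_sqr.
- by apply: continuousD; [apply: continuousM => //|]; exact: cst_continuous.
- by apply: continuousM => //; exact: cst_continuous.
Qed.

Lemma is_derive_sqden (a b : R) (x y : R -> R) t dx dy :
  is_derive t 1 x dx -> is_derive t 1 y dy ->
  is_derive t 1 (fun s => sqden a b (x s) (y s))
    (2 * (a * x t + b) * (a * dx) + 2 * (a * y t) * (a * dy)).
Proof.
move=> hx hy; rewrite /sqden.
under eq_fun do rewrite !expr2.
have hax : is_derive t 1 (fun s => a * x s + b) (a * dx).
  have h := is_deriveD_fun (is_deriveM_fun (is_derive_cst a t 1) hx) (is_derive_cst b t 1).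
  by apply: (is_derive_eq h); rewrite /cst mul0r add0r addr0.
have hay : is_derive t 1 (fun s => a * y s) (a * dy).
  have h := is_deriveM_fun (is_derive_cst a t 1) hy.
  by apply: (is_derive_eq h); rewrite /cst mul0r add0r.
have h := is_deriveD_fun (is_deriveM_fun hax hax) (is_deriveM_fun hay hay).
by apply: (is_derive_eq h); ring.
Qed.

(** Integrates along the path the pointwise bound [axis_coord_1lipschitz]. *)
Lemma hyp_length_ge P (z w : R[i]) (c : R -> R[i]) : \det P = 1 ->
  hyp_path z w c ->
  axis_coord P (complex.Re w) (complex.Im w) -
  axis_coord P (complex.Re z) (complex.Im z) <= hyp_length c.
Proof.
move=> detP [[dx cx'] [dy cy'] c_up c0 c1].
have [Pr0 Pr1] := det1_row_neq0 detP.
rewrite /hyp_length -c0 -c1.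
set x := fun t => complex.Re (c t) in dx cx' *.
set y := fun t => complex.Im (c t) in dy cy' *.
have y0 t : t \in `[0, 1] -> 0 < y t by exact: c_up.
have M0 t : t \in `[0, 1] -> 0 < sqden (P 0 0) (P 0 1) (x t) (y t).
  by move=> /y0; exact: sqden_gt0.
have N0 t : t \in `[0, 1] -> 0 < sqden (P 1 0) (P 1 1) (x t) (y t).
  by move=> /y0; exact: sqden_gt0.
have hx t : is_derive t 1 x (derive1 x t) by exact: derivable_is_derive.
have hy t : is_derive t 1 y (derive1 y t) by exact: derivable_is_derive.
have cx t : {for t, continuous x} by exact: is_derive_continuous (hx t).
have cy t : {for t, continuous y} by exact: is_derive_continuous (hy t).
(* The derivative of [sqden a b] along the path. *)
pose dden a b t := 2 * (a * x t + b) * (a * derive1 x t) +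
                   2 * (a * y t) * (a * derive1 y t).
have cdden a b t : {for t, continuous (dden a b)}.
  have k (r : R) : {for t, continuous (fun _ : R => r)} by exact: cst_continuous.
  exact: (continuousD
    (continuousM (continuousM (k 2) (continuousD (continuousM (k a) (cx t)) (k b)))
                 (continuousM (k a) (cx' t)))
    (continuousM (continuousM (k 2) (continuousM (k a) (cy t)))
                 (continuousM (k a) (cy' t)))).
have := @le_Rintegral_deriv R (fun t => axis_coord P (x t) (y t))
  (fun t => (dden (P 0 0) (P 0 1) t / sqden (P 0 0) (P 0 1) (x t) (y t) -
             dden (P 1 0) (P 1 1) t / sqden (P 1 0) (P 1 1) (x t) (y t)) / 2)
  (fun t => Num.sqrt (derive1 x t ^+ 2 + derive1 y t ^+ 2) / y t) 0 1 ltr01.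
apply.
- move=> t t01; rewrite /axis_coord.
  have h := is_deriveM_fun (is_deriveB_fun
    (@is_derive_ln_fun _ (fun s => sqden (P 0 0) (P 0 1) (x s) (y s)) _ _
      (M0 t t01) (is_derive_sqden (P 0 0) (P 0 1) (hx t) (hy t)))
    (@is_derive_ln_fun _ (fun s => sqden (P 1 0) (P 1 1) (x s) (y s)) _ _
      (N0 t t01) (is_derive_sqden (P 1 0) (P 1 1) (hx t) (hy t))))
    (is_derive_cst (2^-1 : R) t 1).
  by apply: (is_derive_eq h); rewrite mulr0 addr0.
- move=> t t01; apply: continuousM; last exact: cst_continuous.
  apply: continuousB; apply: continuousM => //; apply: continuousV;
    rewrite ?gt_eqF ?M0 ?N0//; exact: continuous_sqden.
- move=> t t01; apply: continuousM; last first.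
    by apply: continuousV; rewrite ?gt_eqF ?y0//.
  apply: (@continuous_comp _ _ _
    (fun t => derive1 x t ^+ 2 + derive1 y t ^+ 2) (@Num.sqrt R));
    last exact: sqrt_continuous.
  by apply: continuousD; apply: continuous_sqr; [exact: cx'|exact: cy'].
- move=> t /subset_itv_oo_cc t01; apply: axis_coord_1lipschitz; rewrite ?y0 ?M0 ?N0//.
  by rewrite -det_mx2.
Qed.

Lemma is_deriveV_fun (f : R -> R) t df : f t != 0 -> is_derive t 1 f df ->
  is_derive t 1 (fun s => (f s)^-1) (- df / f t ^+ 2).
Proof.
move=> f0 hf; have h := is_deriveV f0 hf.
by apply: (is_derive_eq h); rewrite /GRing.scale /=; ring.
Qed.

Lemma is_derive_C1 (f df : R -> R) : (forall t, is_derive t 1 f (df t)) ->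
  continuous df -> C1 f /\ derive1 f = df.
Proof.
move=> hf cdf; have -> : df = derive1 f.
  by apply/funext => t; rewrite derive1E; have := hf t => ?; rewrite derive_val.
split=> //; split=> [t|]; first by have := hf t => ?; exact: ex_derive.
rewrite (_ : derive1 f = df)//; apply/funext => t.
by rewrite derive1E; have := hf t => ?; rewrite derive_val.
Qed.

Lemma hyp_length_ge0 (z w : R[i]) c : hyp_path z w c -> 0 <= hyp_length c.
Proof.
move=> [_ _ c_up _ _]; apply: Rintegral_ge0 => t t01.
by rewrite divr_ge0 ?sqrtr_ge0// ltW//; exact: c_up.
Qed.

(** The straight segment stays in the half-plane by convexity. This makes the set of lengths
    nonempty, without which its infimum would not inherit lower bounds. *)
Lemma hyp_path_ex (z w : R[i]) : upper_half_plane z -> upper_half_plane w ->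
  exists c, hyp_path z w c.
Proof.
case: z => x0 y0; case: w => x1 y1; rewrite /upper_half_plane /= => z0 w0.
have aff (a b : R) : C1 (fun t => a + t * (b - a)).
  have [|//|//] := @is_derive_C1 (fun t => a + t * (b - a)) (fun=> b - a).
  - move=> t.
    have h := is_deriveD_fun (is_derive_cst a t 1)
      (is_deriveM_fun (is_derive_id t 1) (is_derive_cst (b - a) t 1)).
    by apply: (is_derive_eq h); rewrite /cst mulr0 addr0 add0r mul1r.
  - by move=> t; exact: cst_continuous.
exists (fun t => Complex (x0 + t * (x1 - x0)) (y0 + t * (y1 - y0))).
split=> /=; [exact: aff|exact: aff| |by rewrite !mul0r !addr0|].
- move=> t; rewrite in_itv /= => /andP[t0 t1]; rewrite /upper_half_plane /=.
  have -> : y0 + t * (y1 - y0) = (1 - t) * y0 + t * y1 by ring.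
  have [->|t1'] := eqVneq t 1; first by rewrite subrr mul0r add0r mul1r.
  apply: ltr_pwDl; last by rewrite mulr_ge0// ltW.
  by rewrite mulr_gt0// subr_gt0 lt_neqAle t1'.
- by rewrite !mul1r; congr Complex; ring.
Qed.

Lemma mobius_upper A z : \det A = 1 -> upper_half_plane z ->
  upper_half_plane (mobius A z).
Proof.
case: z => x y dA y0; rewrite /upper_half_plane mobiusE /= dA mul1r.
by rewrite divr_gt0//; apply: sqden_gt0 => //; case: (det1_row_neq0 dA).
Qed.

(** Substituting w = A z into |a w + b|^2 multiplies the row (a, b) by [A] on the right and leaves
    the squared denominator of w. *)
Lemma sqden_mobius A (a b x y : R) : \det A = 1 -> 0 < y ->
  sqden a b (complex.Re (mobius A (Complex x y))) (complex.Im (mobius A (Complex x y))) =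
  sqden (a * A 0 0 + b * A 1 0) (a * A 0 1 + b * A 1 1) x y /
  sqden (A 1 0) (A 1 1) x y.
Proof.
move=> dA y0; have N0 : 0 < sqden (A 1 0) (A 1 1) x y.
  by apply: sqden_gt0 => //; case: (det1_row_neq0 dA).
rewrite mobiusE /= det_mx2 -/(sqden _ _ _ _).
move: N0; rewrite /sqden => N0.
by field; rewrite gt_eqF.
Qed.

(** The rows of [P] are scaled by e e^l and e e^(-l). In the difference of logarithms the scalar [e]
    and the denominator of A z cancel, and 2l remains. *)
Lemma axis_coord_mobius A P (e l x y : R) : \det A = 1 -> \det P = 1 ->
  e != 0 -> P *m A = e *: (Dmx l *m P) -> 0 < y ->
  axis_coord P (complex.Re (mobius A (Complex x y)))
               (complex.Im (mobius A (Complex x y))) =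
  axis_coord P x y + 2 * l.
Proof.
move=> dA dP e0 PA y0; rewrite /axis_coord !sqden_mobius// -!mulmx2E PA.
have scaleE (M : 'M[R]_2) i j : (e *: M) i j = e * M i j by rewrite mxE.
rewrite !scaleE !mulmx2E !DmxE !mul0r !addr0 !add0r.
have [Pr0 Pr1] := det1_row_neq0 dP.
have M0 := sqden_gt0 x Pr0 y0; have N0 := sqden_gt0 x Pr1 y0.
have D0 := sqden_gt0 x (det1_row_neq0 dA).2 y0.
have sqdenZ (k a b : R) : sqden (k * a) (k * b) x y = k ^+ 2 * sqden a b x y.
  by rewrite /sqden; ring.
rewrite !mulrA !sqdenZ.
have lneE (k N : R) : 0 < N ->
    ln ((e * expR k) ^+ 2 * N / sqden (A 1 0) (A 1 1) x y) =
    ln (e ^+ 2) + 2 * k + ln N - ln (sqden (A 1 0) (A 1 1) x y).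
  move=> N_gt0.
  have e2 : 0 < e ^+ 2 by rewrite exprn_even_gt0.
  have k2 : 0 < expR k ^+ 2 by rewrite exprn_gt0 ?expR_gt0.
  have ek : 0 < e ^+ 2 * expR k ^+ 2 by exact: mulr_gt0.
  have ekN : 0 < e ^+ 2 * expR k ^+ 2 * N by exact: mulr_gt0.
  rewrite exprMn ln_div ?posrE// [ln (_ * N)]lnM ?posrE//.
  rewrite [ln (_ * expR k ^+ 2)]lnM ?posrE//.
  by rewrite (_ : ln (expR k ^+ 2) = 2 * k)// lnXn ?expR_gt0// expRK mulr_natl.
by rewrite !lneE//; field.
Qed.

(** The real part of P (i s); [axis_y] is its imaginary part. *)
Definition axis_x P (s : R) :=
  (P 0 1 * P 1 1 + P 0 0 * P 1 0 * s ^+ 2) / (P 1 1 ^+ 2 + (P 1 0 * s) ^+ 2).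
Definition axis_y P (s : R) := s / (P 1 1 ^+ 2 + (P 1 0 * s) ^+ 2).

Lemma mobius_axis P s : \det P = 1 ->
  mobius P (Complex 0 s) = Complex (axis_x P s) (axis_y P s).
Proof.
by move=> dP; rewrite mobiusE dP !mulr0 !add0r mul1r.
Qed.

Lemma axis_path_length P (l : R) : \det P = 1 -> 0 <= l ->
  let c := fun t => mobius P (Complex 0 (expR (2 * l * t + 0))) in
  hyp_path (c 0) (c 1) c /\ hyp_length c = 2 * l.
Proof.
move=> dP l0; set s := fun t => expR (2 * l * t + 0).
have s0 t : 0 < s t by exact: expR_gt0.
have ds t : is_derive t 1 s (2 * l * s t) by exact: is_derive_expR_lin.
have cs t : {for t, continuous s} by exact: is_derive_continuous (ds t).
pose d t := P 1 1 ^+ 2 + (P 1 0 * s t) ^+ 2.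
have d0 t : 0 < d t.
  have := sqden_gt0 0 (det1_row_neq0 dP).2 (s0 t).
  by rewrite /sqden mulr0 add0r.
have dd t : is_derive t 1 d (2 * P 1 0 ^+ 2 * s t * (2 * l * s t)).
  have hs := is_deriveM_fun (is_derive_cst (P 1 0) t 1) (ds t).
  have h := is_deriveD_fun (is_derive_cst (P 1 1 ^+ 2) t 1) (is_deriveM_fun hs hs).
  by apply: (is_derive_eq h); rewrite /cst; ring.
have ddV t := is_deriveV_fun (lt0r_neq0 (d0 t)) (dd t).
have k (r t : R) : {for t, continuous (fun _ : R => r)} by exact: cst_continuous.
have cdV t : {for t, continuous (fun u => (d u)^-1)}.
  exact: is_derive_continuous (ddV t).
move=> c; have cE : c = fun t => Complex (axis_x P (s t)) (axis_y P (s t)).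
  by apply/funext => t; rewrite /c mobius_axis.
have [Cx dx] : C1 (fun t => axis_x P (s t)) /\ derive1 (fun t => axis_x P (s t)) =
    (fun t => 2 * P 1 0 * P 1 1 * s t * (2 * l * s t) * (d t)^-1 * (d t)^-1).
  apply: is_derive_C1 => t.
    have h := is_deriveM_fun (is_deriveD_fun (is_derive_cst (P 0 1 * P 1 1) t 1)
      (is_deriveM_fun (is_derive_cst (P 0 0 * P 1 0) t 1)
        (is_deriveM_fun (ds t) (ds t)))) (ddV t).
    apply: (is_derive_eq h); rewrite /cst.
    (* The derivative comes out with the factor det P, so the target is multiplied by it before
       [field]. *)
    have -> : 2 * P 1 0 * P 1 1 * s t * (2 * l * s t) / d t / d t =
       \det P * (2 * P 1 0 * P 1 1 * s t * (2 * l * s t) / d t / d t).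
      by rewrite dP mul1r.
    have := lt0r_neq0 (d0 t); rewrite det_mx2 /d => dn0.
    by field.
  have cc := continuousM (continuousM (k (2 * P 1 0 * P 1 1) t) (cs t))
                         (continuousM (k (2 * l) t) (cs t)).
  exact: (continuousM (continuousM cc (cdV t)) (cdV t)).
have [Cy dy] : C1 (fun t => axis_y P (s t)) /\ derive1 (fun t => axis_y P (s t)) =
    (fun t => (P 1 1 ^+ 2 - (P 1 0 * s t) ^+ 2) * (2 * l * s t) * (d t)^-1 * (d t)^-1).
  apply: is_derive_C1 => t.
    have h := is_deriveM_fun (ds t) (ddV t).
    apply: (is_derive_eq h).
    have := lt0r_neq0 (d0 t); rewrite /d => dn0.
    by field.
  have cc := continuousM (continuousB (k (P 1 1 ^+ 2) t) (continuous_sqr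
     (continuousM (k (P 1 0) t) (cs t)))) (continuousM (k (2 * l) t) (cs t)).
  exact: (continuousM (continuousM cc (cdV t)) (cdV t)).
split.
  split; [by rewrite cE; exact: Cx|by rewrite cE; exact: Cy| |exact: erefl|exact: erefl].
  by move=> t _; apply: (mobius_upper dP); exact: s0.
rewrite /hyp_length cE /= dx dy; apply: Rintegral01_cst => t _.
(* With p = P11 and q = P10 s this is (2pq)^2 + (p^2 - q^2)^2 = (p^2 + q^2)^2. The Euclidean speed
   is 2l s/d and the height s/d, so the hyperbolic speed is constantly 2l. *)
have -> : (2 * P 1 0 * P 1 1 * s t * (2 * l * s t) / d t / d t) ^+ 2 +
    ((P 1 1 ^+ 2 - (P 1 0 * s t) ^+ 2) * (2 * l * s t) / d t / d t) ^+ 2 =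
    (2 * l * s t / d t) ^+ 2.
  by have := lt0r_neq0 (d0 t); rewrite /d => dn0; field.
rewrite sqrtr_sqr ger0_norm; last first.
  by rewrite divr_ge0 ?mulr_ge0// ltW.
rewrite /axis_y -/(d t); field.
by rewrite !lt0r_neq0.
Qed.

Lemma mobius_Dmx l : mobius (Dmx l) (Complex 0 1) = Complex 0 (expR (2 * l)).
Proof.
rewrite mobiusE !DmxE det_mx2 !DmxE; congr Complex.
  by rewrite !(mulr0, mul0r, add0r).
have -> : 2 * l = l + l by ring.
by rewrite expRD expRN; field; rewrite ?gt_eqF ?expR_gt0.
Qed.

Lemma hyp_translation_lengthE (g : PSL2 R) P l : 0 <= l ->
  diagonalizes g P l -> hyp_translation_length g = 2 * l.
Proof.
move=> l0 [dP [e e0]]; set A := sl_val (repr g) => AP.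
have dA : \det A = 1 by exact: sl_det.
have uP : P \in unitmx by rewrite unitmxE dP unitr1.
have PA : invmx P *m A = e *: (Dmx l *m invmx P).
  rewrite -[LHS](mulmxK uP) -[X in X *m invmx P]mulmxA AP -scalemxAr mulKmx//.
  by rewrite -scalemxAl.
have dP' : \det (invmx P) = 1 by rewrite det_inv dP invr1.
have ge_2l z : upper_half_plane z -> 2 * l <= hyp_dist z (hyp_act g z).
  move=> z0; have gz0 : upper_half_plane (hyp_act g z) by exact: mobius_upper.
  apply: lb_le_inf.
    by have [c zc] := hyp_path_ex z0 gz0; exists (hyp_length c), c.
  move=> _ [c zc <-]; have := hyp_length_ge dP' zc.
  apply: le_trans; rewrite /hyp_act -/A.
  move: z0 {gz0 zc}; case: z => x y y0.
  by rewrite (axis_coord_mobius _ _ _ e0 PA)//= addrAC subrr add0r.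
(* The bound is attained at c 0 = P i, which [g] sends to P (i e^(2l)) = c 1. *)
have [cp cl] := axis_path_length dP l0.
set c := (X in hyp_length X) in cp cl.
have cgc : hyp_act g (c 0) = c 1.
  rewrite /hyp_act -/A /c mulr0 mulr1 !addr0 expR0.
  rewrite mobiusM; last by rewrite mobius_denom_neq0// dP oner_neq0.
  rewrite AP mobiusZ// -mobiusM ?mobius_Dmx//.
  rewrite mobius_denom_neq0// det_mx2 !DmxE mul0r subr0 mulf_neq0//.
    by rewrite gt_eqF ?expR_gt0.
  by rewrite gt_eqF ?expR_gt0.
have up0 : upper_half_plane (c 0).
  by apply: mobius_upper => //; exact: expR_gt0.
apply/eqP; rewrite eq_le; apply/andP; split.
  apply: (@le_trans _ _ (hyp_dist (c 0) (hyp_act g (c 0)))).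
    apply: ge_inf; last by exists (c 0).
    by exists (2 * l) => _ [z z0 <-]; exact: ge_2l.
  rewrite -cl cgc; apply: ge_inf; last by exists c.
  by exists 0 => _ [c' c'p <-]; exact: hyp_length_ge0 c'p.
apply: lb_le_inf; first by exists (hyp_dist (c 0) (hyp_act g (c 0))), (c 0).
by move=> _ [z z0 <-]; exact: ge_2l.
Qed.
End Hyperbolic_length.

(** * Boundary dynamics *)

Section Matrix_limits.
Context {R : realType}.
Implicit Types M N : 'M[R]_2.

Lemma cvg_mx2 {T : Type} {F : set_system T} {FF : Filter F} (X : T -> 'M[R]_2) M :
  (forall i j, X t i j @[t --> F] --> M i j) -> X t @[t --> F] --> M.
Proof.
move=> h; apply/cvgrPdist_le => /= e e0.
have h' i j : \forall t \near F, `|M i j - X t i j| <= e.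
  by have /cvgrPdist_le /(_ _ e0) := h i j.
have hall : \forall t \near F, forall i j, `|M i j - X t i j| <= e.
  by apply: filter_forall => i; apply: filter_forall => j.
apply: filterS hall => t ht.
rewrite /Num.Def.normr /= mx_normrE (bigmax_le _ (ltW e0))//= => i _.
by rewrite !mxE.
Qed.

Lemma cvg_coord {T : Type} {F : set_system T} {FF : Filter F} (X : T -> 'M[R]_2) M i j :
  X t @[t --> F] --> M -> X t i j @[t --> F] --> M i j.
Proof.
by move=> h; exact: (cvg_comp _ _ h (@coord_continuous R _ _ i j M)).
Qed.

Lemma cvg_mulmx2 {T : Type} {F : set_system T} {FF : Filter F} (X Y : T -> 'M[R]_2) M N :
  X t @[t --> F] --> M -> Y t @[t --> F] --> N ->
  X t *m Y t @[t --> F] --> M *m N.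
Proof.
move=> hX hY; apply: cvg_mx2 => i j.
under eq_fun do rewrite mulmx2E.
by rewrite mulmx2E; apply: cvgD; apply: cvgM; exact: cvg_coord.
Qed.

Lemma cvg_det2 {T : Type} {F : set_system T} {FF : Filter F} (X : T -> 'M[R]_2) M :
  X t @[t --> F] --> M -> \det (X t) @[t --> F] --> \det M.
Proof.
move=> hX; under eq_fun do rewrite det_mx2.
by rewrite det_mx2; apply: cvgB; apply: cvgM; exact: cvg_coord.
Qed.

Lemma cvg_entries {T : Type} {F : set_system T} {FF : Filter F} (X : T -> 'M[R]_2) M :
  X t 0 0 @[t --> F] --> M 0 0 -> X t 0 1 @[t --> F] --> M 0 1 ->
  X t 1 0 @[t --> F] --> M 1 0 -> X t 1 1 @[t --> F] --> M 1 1 ->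
  X t @[t --> F] --> M.
Proof.
move=> h00 h01 h10 h11; apply: cvg_mx2 => i j.
by case: (ord2P i) => ->; case: (ord2P j) => ->.
Qed.

End Matrix_limits.

(** * Charts on the projective space of matrices *)

Section Chart.
Context {R : realType}.
Implicit Types (A P Q M N : 'M[R]_2) (l m t : R) (g : PSL2 R) (p : @Defs.proj R).

Definition chart P Q M := invmx P *m M *m Q.
Definition unchart P Q N := P *m N *m invmx Q.
Definition sqnorm N := N 0 0 ^+ 2 + N 0 1 ^+ 2 + N 1 0 ^+ 2 + N 1 1 ^+ 2.
(** Homogeneous of degree 0, hence a real function on [proj]; among nonzero matrices it takes the
    value 1 exactly on the line of P E00 Q^-1. *)
Definition cornerfrac P Q M := chart P Q M 0 0 ^+ 2 / sqnorm (chart P Q M).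
Definition corner P Q p := cornerfrac P Q (set_val (repr p)).

Lemma chartK P Q : \det P = 1 -> \det Q = 1 -> cancel (chart P Q) (unchart P Q).
Proof.
move=> dP dQ M; rewrite /chart /unchart !mulmxA mulmxV ?unitmx_det1// mul1mx.
by rewrite mulmxK ?unitmx_det1.
Qed.

Lemma unchartK P Q : \det P = 1 -> \det Q = 1 -> cancel (unchart P Q) (chart P Q).
Proof.
move=> dP dQ M; rewrite /chart /unchart !mulmxA mulVmx ?unitmx_det1// mul1mx.
by rewrite mulmxKV ?unitmx_det1.
Qed.

Lemma chartZ P Q (k : R) M : chart P Q (k *: M) = k *: chart P Q M.
Proof. by rewrite /chart -scalemxAr -scalemxAl. Qed.

Lemma unchartZ P Q (k : R) M : unchart P Q (k *: M) = k *: unchart P Q M.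
Proof. by rewrite /unchart -scalemxAr -scalemxAl. Qed.

Lemma det_chart P Q M : \det P = 1 -> \det Q = 1 -> \det (chart P Q M) = \det M.
Proof.
by move=> dP dQ; rewrite /chart !det_mulmx det_inv dP dQ invr1 mul1r mulr1.
Qed.

Lemma det_unchart P Q M : \det P = 1 -> \det Q = 1 -> \det (unchart P Q M) = \det M.
Proof.
by move=> dP dQ; rewrite /unchart !det_mulmx det_inv dP dQ invr1 mul1r mulr1.
Qed.

Lemma chart_neq0 P Q M : \det P = 1 -> \det Q = 1 -> M != 0 -> chart P Q M != 0.
Proof.
move=> dP dQ; apply: contra_neq => h.
by rewrite -(chartK dP dQ M) h /unchart mulmx0 mul0mx.
Qed.

Lemma unchart_neq0 P Q M : \det P = 1 -> \det Q = 1 -> M != 0 -> unchart P Q M != 0.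
Proof.
move=> dP dQ; apply: contra_neq => h.
by rewrite -(unchartK dP dQ M) h /chart mulmx0 mul0mx.
Qed.

Lemma sqnorm_gt0 N : N != 0 -> 0 < sqnorm N.
Proof.
apply: contraTT; rewrite -leNgt /sqnorm => h.
have := sqr_ge0 (N 0 0); have := sqr_ge0 (N 0 1).
have := sqr_ge0 (N 1 0); have := sqr_ge0 (N 1 1) => d0 c0 b0 a0.
have z (x : R) : x ^+ 2 <= 0 -> x = 0.
  by move=> x0; apply/eqP; rewrite -sqrf_eq0 eq_le x0 sqr_ge0.
by rewrite negbK; apply/eqP/matrix2P; rewrite mxE; apply: z; lra.
Qed.

Lemma sqnormZ (k : R) N : sqnorm (k *: N) = k ^+ 2 * sqnorm N.
Proof. by rewrite /sqnorm !scalemx2E; ring. Qed.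

Lemma cornerfracZ P Q (k : R) M : k != 0 -> cornerfrac P Q (k *: M) = cornerfrac P Q M.
Proof.
move=> k0; rewrite /cornerfrac chartZ sqnormZ scalemx2E exprMn -mulf_div.
by rewrite divff ?mul1r// sqrf_eq0.
Qed.

Lemma cvg_chart {T : Type} {F : set_system T} {FF : Filter F} P Q (X : T -> 'M[R]_2) M :
  X t @[t --> F] --> M -> chart P Q (X t) @[t --> F] --> chart P Q M.
Proof.
by move=> hX; apply: cvg_mulmx2; [apply: cvg_mulmx2 hX|]; exact: cvg_cst.
Qed.

Lemma cvg_unchart {T : Type} {F : set_system T} {FF : Filter F} P Q (X : T -> 'M[R]_2) M :
  X t @[t --> F] --> M -> unchart P Q (X t) @[t --> F] --> unchart P Q M.
Proof.
by move=> hX; apply: cvg_mulmx2; [apply: cvg_mulmx2 hX|]; exact: cvg_cst.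
Qed.

Lemma cvg_sqr {T : Type} {F : set_system T} {FF : Filter F} (f : T -> R) (a : R) :
  f t @[t --> F] --> a -> f t ^+ 2 @[t --> F] --> a ^+ 2.
Proof. by move=> h; exact: cvgM. Qed.

Lemma cvg_sqnorm {T : Type} {F : set_system T} {FF : Filter F} (X : T -> 'M[R]_2) M :
  X t @[t --> F] --> M -> sqnorm (X t) @[t --> F] --> sqnorm M.
Proof.
move=> hX; apply: cvgD; [apply: cvgD; [apply: cvgD|]|].
- exact: cvg_sqr (cvg_coord hX).
- exact: cvg_sqr (cvg_coord hX).
- exact: cvg_sqr (cvg_coord hX).
- exact: cvg_sqr (cvg_coord hX).
Qed.

Lemma cvg_cornerfrac {T : Type} {F : set_system T} {FF : Filter F} P Q (X : T -> 'M[R]_2) M :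
  \det P = 1 -> \det Q = 1 -> M != 0 ->
  X t @[t --> F] --> M -> cornerfrac P Q (X t) @[t --> F] --> cornerfrac P Q M.
Proof.
move=> dP dQ M0 hX.
have hC : chart P Q (X t) @[t --> F] --> chart P Q M by exact: cvg_chart.
apply: cvgM; first exact: cvg_sqr (cvg_coord hC).
apply: cvgV; last exact: cvg_sqnorm hC.
by rewrite gt_eqF// sqnorm_gt0// chart_neq0.
Qed.

Lemma pi_proj_eq (M N : @nzmx R) (k : R) : k != 0 -> set_val M = k *: set_val N ->
  \pi_(@Defs.proj R) M = \pi_(@Defs.proj R) N.
Proof.
by move=> k0 MN; apply/eqmodP; apply/asboolP; exists k.
Qed.

Lemma repr_proj (M : @nzmx R) : exists2 k : R, k != 0 &
  set_val (repr (\pi_(@Defs.proj R) M)) = k *: set_val M.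
Proof.
by have /eqmodP/asboolP := reprK (\pi_(@Defs.proj R) M).
Qed.

Lemma corner_pi P Q (M : @nzmx R) :
  corner P Q (\pi_(@Defs.proj R) M) = cornerfrac P Q (set_val M).
Proof.
by rewrite /corner; have [k k0 ->] := repr_proj M; rewrite cornerfracZ.
Qed.

(** On the quotient topology, continuity upstairs and constancy on classes suffice. *)
Lemma corner_continuous P Q : \det P = 1 -> \det Q = 1 -> continuous (corner P Q).
Proof.
move=> dP dQ.
apply: (@repr_comp_continuous _ _ _ (fun M : @nzmx R => cornerfrac P Q (set_val M))).
  move=> M; have h : set_val N @[N --> M] --> (set_val M : 'M[R]_2).
    exact: (@initial_continuous _ _ set_val M).
  exact: (cvg_cornerfrac dP dQ (set_valP M) h).
by move=> M N /eqP MN; rewrite -!corner_pi MN.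
Qed.
End Chart.

(** * Attracting fixed points of a pair *)

Section Attracting.
Context {R : realType}.
Implicit Types (A P Q M N : 'M[R]_2) (l m t : R) (g : PSL2 R) (p : @Defs.proj R).

Definition mknz M (M0 : M != 0) : @nzmx R :=
  exist (fun N => N \in nzmx) M (mem_set (M0 : nzmx M)).

Lemma set_val_nz_act (A B : SL2 R) (M : @nzmx R) :
  set_val (nz_act A B M) = sl_val A *m set_val M *m invmx (sl_val B).
Proof. by []. Qed.

Lemma cvg_nzmx {T : Type} {F : set_system T} {FF : Filter F}
    (X : T -> @nzmx R) (M : @nzmx R) :
  (set_val (X t) : 'M[R]_2) @[t --> F] --> (set_val M : 'M[R]_2) ->
  X t @[t --> F] --> M.
Proof.
move=> h U; rewrite nbhsE => -[V [[B oB BV] VM] VU].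
have BM : nbhs (set_val M : 'M[R]_2) B.
  by apply: open_nbhs_nbhs; split=> //; move: VM; rewrite -BV.
have hB : \forall t \near F, B (set_val (X t)).
  exact: h.
by apply: filterS hB => t Bt; apply: VU; rewrite -BV.
Qed.

Lemma cvg_pi_proj {T : Type} {F : set_system T} {FF : Filter F}
    (X : T -> @nzmx R) (M : @nzmx R) :
  (set_val (X t) : 'M[R]_2) @[t --> F] --> (set_val M : 'M[R]_2) ->
  \pi_(@Defs.proj R) (X t) @[t --> F] --> \pi_(@Defs.proj R) M.
Proof.
move=> h; exact: (cvg_comp _ _ (cvg_nzmx h) (@pi_continuous _ _ M)).
Qed.

(* The X t need not converge in the matrix space: only their rescalings do. *)
Lemma cvg_pi_proj_scale {T : Type} {F : set_system T} {FF : Filter F}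
    (X : T -> @nzmx R) (k : T -> R) (M : @nzmx R) :
  (forall u, k u != 0) ->
  k t *: (set_val (X t) : 'M[R]_2) @[t --> F] --> (set_val M : 'M[R]_2) ->
  \pi_(@Defs.proj R) (X t) @[t --> F] --> \pi_(@Defs.proj R) M.
Proof.
move=> k0 h.
have X0 u : (set_val (X u) : 'M[R]_2) != 0 by exact: (set_valP (X u)).
have kX0 u : k u *: (set_val (X u) : 'M[R]_2) != 0.
  by rewrite scaler_eq0 negb_or k0 X0.
rewrite (_ : (fun u => \pi_(@Defs.proj R) (X u)) =
             (fun u => \pi_(@Defs.proj R) (mknz (kX0 u)))); last first.
  apply/funext => u; apply: (@pi_proj_eq _ _ _ (k u)^-1); first by rewrite invr_eq0.
  by rewrite /= scalerA mulVf// scale1r.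
exact: cvg_pi_proj.
Qed.

Definition E00 : 'M[R]_2 := mx2 1 0 0 0.

Lemma E00_neq0 : E00 != 0.
Proof.
by apply/eqP => /matrixP /(_ 0 0); rewrite mx2E mxE => /eqP; rewrite oner_eq0.
Qed.

Lemma unchart_E00_neq0 P Q : \det P = 1 -> \det Q = 1 -> unchart P Q E00 != 0.
Proof. by move=> dP dQ; rewrite unchart_neq0// E00_neq0. Qed.

Lemma cornerfrac_E00 P Q : \det P = 1 -> \det Q = 1 ->
  cornerfrac P Q (unchart P Q E00) = 1.
Proof.
move=> dP dQ; rewrite /cornerfrac unchartK//.
by rewrite /sqnorm !mx2E expr1n expr0n /= !addr0 divr1.
Qed.

Lemma boundary_pi (M : @nzmx R) :
  boundary (\pi_(@Defs.proj R) M) <-> \det (set_val M) = 0.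
Proof.
rewrite /boundary /mkset; have [k k0 ->] := repr_proj M.
rewrite detZ; split=> [/eqP|->]; last by rewrite mulr0.
by rewrite mulf_eq0 expf_eq0 (negbTE k0) andbF => /eqP.
Qed.

Section Pair.
Variables (g1 g2 : PSL2 R) (P Q : 'M[R]_2) (l m : R).
Hypotheses (l0 : 0 < l) (m0 : 0 < m).
Hypotheses (dgP : diagonalizes g1 P l) (dgQ : diagonalizes g2 Q (- m)).

Let dP : \det P = 1 := dgP.1.
Let dQ : \det Q = 1 := dgQ.1.

(** The second factor acts through its inverse, which turns the exponent [- m] into [m]: both sides
    stretch the same corner, and this is why the two lengths add up. *)
Lemma chart_act : exists2 e, e != 0 & forall M,
  chart P Q (sl_val (repr g1) *m M *m invmx (sl_val (repr g2))) =
  e *: (Dmx l *m chart P Q M *m Dmx m).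
Proof.
case: dgP => _ [e e0 AP]; case: dgQ => _ [k k0 BQ].
exists (e / k); first by rewrite mulf_neq0 ?invr_eq0.
have uP := unitmx_det1 dP; have uQ := unitmx_det1 dQ.
have PA : invmx P *m sl_val (repr g1) = e *: (Dmx l *m invmx P).
  rewrite -[LHS](mulmxK uP) -[X in X *m invmx P]mulmxA AP -scalemxAr mulKmx//.
  by rewrite -scalemxAl.
have BVQ : invmx (sl_val (repr g2)) *m Q = k^-1 *: (Q *m Dmx m).
  have uB := sl_unit (repr g2).
  apply: (can_inj (mulKmx uB)); rewrite mulKVmx//.
  rewrite -scalemxAr mulmxA BQ -scalemxAl scalerA mulVf// scale1r.
  by rewrite -mulmxA -DmxD addNr Dmx0 mulmx1.
move=> M; rewrite /chart !mulmxA PA -!mulmxA BVQ.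
by rewrite -!scalemxAl -!scalemxAr scalerA !mulmxA.
Qed.

Let act := nz_act (repr g1) (repr g2).

Lemma proj_act_pi (M : @nzmx R) :
  proj_act (g1, g2) (\pi_(@Defs.proj R) M) = \pi_(@Defs.proj R) (act M).
Proof.
rewrite /proj_act /=; have [k k0 kM] := repr_proj M.
by apply: (pi_proj_eq k0); rewrite !set_val_nz_act kM -scalemxAr -scalemxAl.
Qed.

Lemma iter_proj_act_pi n (M : @nzmx R) :
  iter n (proj_act (g1, g2)) (\pi_(@Defs.proj R) M) = \pi_(@Defs.proj R) (iter n act M).
Proof. by elim: n => //= n ->; rewrite proj_act_pi. Qed.

Lemma iter_proj_act_cvg p : corner P Q p != 0 ->
  iter n (proj_act (g1, g2)) p @[n --> \oo] -->
    \pi_(@Defs.proj R) (mknz (unchart_E00_neq0 dP dQ)).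
Proof.
rewrite -[p]reprK; move: (repr p) => M {p}; rewrite corner_pi => rM.
have [e e0 actE] := chart_act.
set N := chart P Q (set_val M).
have N00 : N 0 0 != 0.
  by apply: contra_neq rM => N0; rewrite /cornerfrac -/N N0 expr0n mul0r.
have iterE n : chart P Q (set_val (iter n act M)) =
    e ^+ n *: (Dmx (l * n%:R) *m N *m Dmx (m * n%:R)).
  elim: n => [|n IHn]; first by rewrite !mulr0 expr0 scale1r !Dmx0 mul1mx mulmx1.
  rewrite iterS set_val_nz_act actE IHn -!scalemxAr -!scalemxAl scalerA -exprS.
  congr (_ *: _).
  by rewrite -natr1 !mulrDr !mulr1 [l * _ + l]addrC !DmxD !mulmxA.
under eq_fun do rewrite iter_proj_act_pi.
(* The inverse of the (0,0) entry of the n-th iterate in the chart. *)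
pose k n := (N 0 0 * (e * expR (l + m)) ^+ n)^-1.
apply: (@cvg_pi_proj_scale _ _ _ _ k).
  move=> n; rewrite invr_eq0 mulf_neq0// expf_neq0// mulf_neq0//.
  by rewrite gt_eqF ?expR_gt0.

have N00k n : k n * e ^+ n = (N 0 0)^-1 * expR (- (l + m)) ^+ n.
  rewrite /k exprMn !invfM expRN exprVn; field.
  by rewrite N00 !expf_neq0// gt_eqF ?expR_gt0.
(* Once the corner is normalised to 1, the other entries decay geometrically. *)
have kE n : k n *: (set_val (iter n act M) : 'M[R]_2) =
    unchart P Q (mx2 1 (N 0 1 / N 0 0 * expR (- (2 * m)) ^+ n)
                       (N 1 0 / N 0 0 * expR (- (2 * l)) ^+ n)
                       (N 1 1 / N 0 0 * expR (- (2 * (l + m))) ^+ n)).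
  rewrite -[set_val _](chartK dP dQ) iterE unchartZ scalerA -unchartZ N00k.
  congr unchart; rewrite -!expRM_natr; clearbody N.
  have a0 := lt0r_neq0 (expR_gt0 (l * n%:R)).
  have b0 := lt0r_neq0 (expR_gt0 (m * n%:R)).
  have -> : expR (- (l + m) * n%:R) = (expR (l * n%:R) * expR (m * n%:R))^-1.
    by rewrite -expRD -expRN; congr expR; ring.
  have -> : expR (- (2 * m) * n%:R) = (expR (m * n%:R))^-1 ^+ 2.
    by rewrite expr2 -expRN -expRD; congr expR; ring.
  have -> : expR (- (2 * l) * n%:R) = (expR (l * n%:R))^-1 ^+ 2.
    by rewrite expr2 -expRN -expRD; congr expR; ring.
  have -> : expR (- (2 * (l + m)) * n%:R) =
      (expR (l * n%:R) * expR (m * n%:R))^-1 ^+ 2.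
    by rewrite expr2 -expRD -expRN -expRD; congr expR; ring.
  apply: matrix2P; rewrite scalemx2E !mulmx2E !mx2E !DmxE ?expRN;
    by field; rewrite N00 a0 b0.
under eq_fun do rewrite kE.
apply: cvg_unchart; rewrite /E00.
have geo (a b : R) : 0 < b -> a * expR (- (2 * b)) ^+ n @[n --> \oo] --> (0 : R).
  move=> b0; rewrite -[X in _ --> X](mulr0 a); apply: cvgM; first exact: cvg_cst.
  apply: cvg_expr; rewrite ger0_norm ?expR_ge0// expR_lt1.
  by rewrite oppr_lt0 mulr_gt0.
apply: cvg_entries; under eq_fun do rewrite mx2E; rewrite mx2E.
- exact: cvg_cst.
- exact: geo.
- exact: geo.
- by apply: geo; rewrite addr_gt0.
Qed.

Let pt := \pi_(@Defs.proj R) (mknz (unchart_E00_neq0 dP dQ)).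

Lemma corner_pt : corner P Q pt = 1.
Proof. by rewrite corner_pi cornerfrac_E00. Qed.

(** By continuity [corner] stays nonzero near [pt], so [iter_proj_act_cvg] covers a whole
    neighbourhood. *)
Lemma attracting_pt : attracting (g1, g2) pt.
Proof.
split.
- apply/boundary_pi; rewrite [set_val _]/= det_unchart// det_mx2 !mx2E; ring.
- rewrite proj_act_pi; have [e e0 actE] := chart_act.
  apply: (@pi_proj_eq _ _ _ (e * expR (l + m))).
    by rewrite mulf_neq0// gt_eqF ?expR_gt0.
  rewrite -[LHS](chartK dP dQ) set_val_nz_act actE /= unchartK//.
  rewrite unchartZ -scalerA -[in RHS]unchartZ.
  congr (_ *: unchart _ _ _); rewrite expRD.
  by apply: matrix2P; rewrite scalemx2E !mulmx2E !DmxE !mx2E; ring.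
- have h : \forall x \near pt, corner P Q x != 0.
    apply: (@cvgr_neq0 _ _ _ _ _ (corner P Q) _ (@corner_continuous _ P Q dP dQ pt)).
    by rewrite corner_pt oner_neq0.
  by apply: filterS h => x xn0 _; exact: iter_proj_act_cvg.
Qed.

Let sl_of A (dA : \det A = 1) : SL2 R := MkSL2 (introT eqP dA).

Lemma attracting_corner p : attracting (g1, g2) p -> corner P Q p = 1.
Proof.
move=> [bp _ near_p]; apply: contrapT => rp.
have near0 : \forall x \near p, boundary x -> corner P Q x = 0.
  (* If [corner] were nonzero at x, the orbit of x would converge both to p and to [pt], and
     [corner] would take the value 1 at p. *)
  apply: filterS near_p => x + bx => /(_ bx) xp; apply: contrapT => /eqP rx.
  have cp : corner P Q (iter n (proj_act (g1, g2)) x) @[n --> \oo] --> corner P Q p.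
    exact: (cvg_comp _ _ xp (@corner_continuous _ P Q dP dQ p)).
  have c1 : corner P Q (iter n (proj_act (g1, g2)) x) @[n --> \oo] --> (1 : R).
    rewrite -corner_pt.
    exact: (cvg_comp _ _ (iter_proj_act_cvg rx) (@corner_continuous _ P Q dP dQ pt)).
  by apply: rp; exact: (cvg_unique _ cp c1).
move: bp near0 rp; rewrite -[p]reprK; move: (repr p) => M {p near_p}.
move=> /boundary_pi dM near0 _.
(* Unipotent factors on both sides move [M] inside the boundary. In the chart the (0,0) entry
   becomes N00 + t (N01 + N10) + t^2 N11; [V] carries [- t] because its inverse acts. *)
pose U t := unchart P P (mx2 1 t 0 1); pose V t := unchart Q Q (mx2 1 0 (- t) 1).
have dU t : \det (U t) = 1 by rewrite det_unchart// det_mx2 !mx2E; ring.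
have dV t : \det (V t) = 1 by rewrite det_unchart// det_mx2 !mx2E; ring.
have VV t : invmx (V t) = unchart Q Q (mx2 1 0 t 1).
  have uV := unitmx_det1 (dV t).
  apply: (can_inj (mulKmx uV)); rewrite mulmxV//.
  rewrite /V /unchart !mulmxA mulmxKV ?unitmx_det1//.
  rewrite -[Q *m _ *m _]mulmxA (_ : mx2 1 0 (- t) 1 *m mx2 1 0 t 1 = 1%:M).
    by rewrite mulmx1 mulmxV ?unitmx_det1.
  by apply: matrix2P; rewrite !mulmx2E !mx2E !mxE /=; ring.
pose X t := nz_act (sl_of (dU t)) (sl_of (dV t)) M.
set N := chart P Q (set_val M).
have XE t : (set_val (X t) : 'M[R]_2) = unchart P Q (mx2 1 t 0 1 *m N *m mx2 1 0 t 1).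
  rewrite set_val_nz_act /= VV /U /N /unchart /chart !mulmxA.
  by rewrite -!mulmxA.
have ME : (set_val M : 'M[R]_2) = unchart P Q (mx2 1 0 0 1 *m N *m mx2 1 0 0 1).
  rewrite (_ : mx2 1 0 0 1 = 1%:M) ?mul1mx ?mulmx1 ?chartK//.
  by apply: matrix2P; rewrite mx2E mxE.
have Xcvg : X t @[t --> (0 : R)] --> M.
  apply: cvg_nzmx; under eq_fun do rewrite XE.
  rewrite ME; apply: cvg_unchart; apply: cvg_mulmx2; first apply: cvg_mulmx2.
  - by apply: cvg_entries; under eq_fun do rewrite mx2E; rewrite mx2E;
      first [exact: cvg_cst|exact: cvg_id].
  - exact: cvg_cst.
  - by apply: cvg_entries; under eq_fun do rewrite mx2E; rewrite mx2E;
      first [exact: cvg_cst|exact: cvg_id].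
have near1 : \forall t \near (0 : R),
    boundary (\pi_(@Defs.proj R) (X t)) -> corner P Q (\pi_(@Defs.proj R) (X t)) = 0.
  have hp : \pi_(@Defs.proj R) (X t) @[t --> (0 : R)] --> \pi_(@Defs.proj R) M.
    exact: (cvg_comp _ _ Xcvg (@pi_continuous _ _ M)).
  exact: (hp _ near0).
have dN0 : \det N = 0 by rewrite det_chart.
have poly0 : \forall t \near (0 : R),
    N 0 0 + t * (N 0 1 + N 1 0) + t ^+ 2 * N 1 1 = 0.
  apply: filterS near1 => t.
  have -> : boundary (\pi_(@Defs.proj R) (X t)) = True.
    apply/propext; split=> // _; apply/boundary_pi.
    by rewrite XE det_unchart// det_mulmx [\det (_ *m N)]det_mulmx dN0 mulr0 mul0r.
  move=> /(_ I) /eqP; rewrite corner_pi /cornerfrac XE unchartK//.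
  rewrite mulf_eq0 sqrf_eq0 invr_eq0 => /orP[/eqP <-|].
    by rewrite !mulmx2E !mx2E; ring.
  rewrite gt_eqF// sqnorm_gt0//.
  rewrite -[_ *m _](unchartK dP dQ) -XE chart_neq0//; exact: (set_valP (X t)).
(* A quadratic polynomial vanishing at 0 and at +-e/2 is zero, so N00 = N11 = 0 and N10 = - N01; det
   N = 0 then gives N = 0, a contradiction. *)
have {poly0} [e /= e0 pe] := (nbhs_ballP _ _).1 poly0.
have := pe 0 (ballxx _ e0).
have e2 : ball 0 e (e / 2) by rewrite /ball /= sub0r normrN ger0_norm; lra.
have e2N : ball 0 e (- (e / 2)) by rewrite /ball /= sub0r opprK ger0_norm; lra.
move: (pe _ e2) (pe _ e2N) => /= p1 p2; rewrite expr0n /= !mul0r !addr0 => p0.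
have N0 : N != 0 by rewrite chart_neq0//; exact: (set_valP M).
have dN : N 0 0 * N 1 1 - N 0 1 * N 1 0 = 0 by rewrite -det_mx2.
clearbody N.
have d0 : N 1 1 = 0.
  have : (e / 2) ^+ 2 * N 1 1 = 0.
    by move: p1 p2; rewrite p0 => p1 p2; lra.
  move/eqP; rewrite mulf_eq0 sqrf_eq0 mulf_eq0 gt_eqF//= invr_eq0 pnatr_eq0 /=.
  by move/eqP.
have c0 : N 1 0 = - N 0 1.
  have : e / 2 * (N 0 1 + N 1 0) = 0.
    by move: p1; rewrite p0 d0 mulr0 addr0 add0r.
  move/eqP; rewrite mulf_eq0 mulf_eq0 gt_eqF//= invr_eq0 pnatr_eq0 /= => /eqP bc.
  by apply/eqP; rewrite -addr_eq0 addrC bc.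
have b0 : N 0 1 = 0.
  move: dN; rewrite p0 c0 mul0r sub0r mulrN opprK => /eqP.
  by rewrite mulf_eq0 orbb => /eqP.
by move/eqP: N0; apply; apply: matrix2P; rewrite mxE ?c0 ?b0 ?oppr0.
Qed.

End Pair.
End Attracting.

(** * Spacelike geodesics *)

Section Geodesics.
Context {R : realType}.
Implicit Types (A P Q M N V W : 'M[R]_2) (t s : R) (c : R -> SL2 R).

Lemma is_derive_entry (X : R -> 'M[R]_2) t i j : derivable X t 1 ->
  is_derive t 1 (fun s => X s i j) (derive1 X t i j).
Proof.
move=> dX; rewrite derive1E derive_mx// mxE.
by have /derivable_mxP/(_ i j) dij := dX; exact: DeriveDef.
Qed.

Lemma is_derive_entries (X X' : R -> 'M[R]_2) t :
  (forall i j, is_derive t 1 (fun s => X s i j) (X' t i j)) ->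
  derivable X t 1 /\ derive1 X t = X' t.
Proof.
move=> h; have dX : derivable X t 1.
  by apply/derivable_mxP => i j; have := h i j => ?; exact: ex_derive.
split=> //; rewrite derive1E derive_mx//; apply/matrixP => i j; rewrite mxE.
by have := h i j => ?; rewrite derive_val.
Qed.

Lemma is_derive_cst0 (f : R -> R) t r d :
  (forall s, f s = r) -> is_derive t 1 f d -> d = 0.
Proof.
move=> fr; have -> : f = cst r by exact/funext.
by move=> df; rewrite -(@derive_val _ _ _ _ _ _ _ df) derive_cst.
Qed.

Lemma ads_formE V W : ads_form V W =
  - (V 0 0 * W 1 1 + V 1 1 * W 0 0 - V 0 1 * W 1 0 - V 1 0 * W 0 1) / 2.
Proof. by rewrite /ads_form !det_mx2 !mxE; congr (- _ / _); ring. Qed.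

(** The equation f'' = s^2 f splits into first-order ones for g + s f and g - s f, which makes [p]
    and [q] constant. *)
Lemma ode_hyperbolic (f g : R -> R) s : s != 0 ->
  (forall t, is_derive t 1 f (g t)) ->
  (forall t, is_derive t 1 g (s ^+ 2 * f t)) ->
  forall t, f t = (f 0 + g 0 / s) / 2 * expR (s * t) +
                  (f 0 - g 0 / s) / 2 * expR (- (s * t)).
Proof.
move=> s0 df dg t.
pose p u := (g u + s * f u) * expR (- s * u + 0).
pose q u := (g u - s * f u) * expR (s * u + 0).
have dp (u : R) : is_derive u 1 p 0.
  have h := is_deriveM_fun (is_deriveD_fun (dg u)
    (is_deriveM_fun (is_derive_cst s u 1) (df u))) (is_derive_expR_lin (- s) 0 u).
  by apply: (is_derive_eq h); rewrite /cst; ring.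
have dq (u : R) : is_derive u 1 q 0.
  have h := is_deriveM_fun (is_deriveB_fun (dg u)
    (is_deriveM_fun (is_derive_cst s u 1) (df u))) (is_derive_expR_lin s 0 u).
  by apply: (is_derive_eq h); rewrite /cst; ring.
have := is_derive_0_is_cst t 0 dp; have := is_derive_0_is_cst t 0 dq.
rewrite /p /q !mulr0 !addr0 expR0 !mulr1 mulNr expRN => q0 p0.
have e0 := lt0r_neq0 (expR_gt0 (s * t)).
have gp : g t + s * f t = (g 0 + s * f 0) * expR (s * t).
  by rewrite -p0 mulfVK.
have gm : g t - s * f t = (g 0 - s * f 0) / expR (s * t).
  by rewrite -q0 mulfK.
have -> : f t = ((g t + s * f t) - (g t - s * f t)) / (2 * s) by field.
rewrite gp gm; field; by rewrite s0 e0.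
Qed.

Lemma spacelike_geodesicE c : geodesic c -> spacelike c ->
  exists s U W, 0 < s /\ forall t,
    sl_val (c t) = expR (s * t) *: U + expR (- (s * t)) *: W.
Proof.
move=> [dc dv geo] sp.
set v := velocity c in dv geo *; set a := fun t => derive1 v t.
have xv (t : R) i j : is_derive t 1 (fun s => sl_val (c s) i j) (v t i j).
  exact: is_derive_entry.
have va (t : R) i j : is_derive t 1 (fun s => v s i j) (a t i j).
  by exact: is_derive_entry.
have {}geo t V : ads_form (c t) V = 0 -> ads_form (a t) V = 0 by exact: geo.
clearbody a.
have det1 t : c t 0 0 * c t 1 1 - c t 0 1 * c t 1 0 = 1.
  by rewrite -det_mx2 sl_det.
(* Differentiating det c = 1, once here and a second time in [da0]. *)
have dv0 t : v t 0 0 * c t 1 1 + c t 0 0 * v t 1 1 -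
    (v t 0 1 * c t 1 0 + c t 0 1 * v t 1 0) = 0.
  apply: (is_derive_cst0 det1).
  exact: (is_deriveB_fun (is_deriveM_fun (xv t 0 0) (xv t 1 1))
    (is_deriveM_fun (xv t 0 1) (xv t 1 0))).
have da0 t : a t 0 0 * c t 1 1 + v t 0 0 * v t 1 1 +
      (v t 0 0 * v t 1 1 + c t 0 0 * a t 1 1) -
    (a t 0 1 * c t 1 0 + v t 0 1 * v t 1 0 +
      (v t 0 1 * v t 1 0 + c t 0 1 * a t 1 0)) = 0.
  apply: (is_derive_cst0 dv0).
  exact: (is_deriveB_fun
   (is_deriveD_fun (is_deriveM_fun (va t 0 0) (xv t 1 1))
      (is_deriveM_fun (xv t 0 0) (va t 1 1)))
   (is_deriveD_fun (is_deriveM_fun (va t 0 1) (xv t 1 0))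
      (is_deriveM_fun (xv t 0 1) (va t 1 0)))).
(* Each W is a tangent vector plus a multiple of c, since c has square -1. As the acceleration kills
   tangent vectors, it is k c, and [da0] then reads 2 (k + det v) = 0. *)
have aE t : a t = (- \det (v t)) *: sl_val (c t).
  pose k := - ads_form (a t) (c t).
  have fcc : ads_form (c t) (c t) = -1.
    rewrite ads_formE; have -> : c t 0 0 * c t 1 1 + c t 1 1 * c t 0 0 -
      c t 0 1 * c t 1 0 - c t 1 0 * c t 0 1 =
      2 * (c t 0 0 * c t 1 1 - c t 0 1 * c t 1 0) by ring.
    by rewrite det1 mulr1 mulNr divff.
  have fa W : ads_form (a t) W = k * ads_form (c t) W.
    have fD X (r : R) : ads_form X (W + r *: sl_val (c t)) =
        ads_form X W + r * ads_form X (c t).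
      by rewrite !ads_formE !mxE; ring.
    have := geo t (W + ads_form (c t) W *: sl_val (c t)).
    rewrite !fD fcc mulrN1 subrr => /(_ erefl) /eqP.
    by rewrite addr_eq0 => /eqP ->; rewrite /k; ring.
  have a00 : a t 0 0 = k * c t 0 0.
    by have := fa (mx2 0 0 0 1); rewrite !ads_formE !mx2E; lra.
  have a11 : a t 1 1 = k * c t 1 1.
    by have := fa (mx2 1 0 0 0); rewrite !ads_formE !mx2E; lra.
  have a01 : a t 0 1 = k * c t 0 1.
    by have := fa (mx2 0 0 1 0); rewrite !ads_formE !mx2E; lra.
  have a10 : a t 1 0 = k * c t 1 0.
    by have := fa (mx2 0 1 0 0); rewrite !ads_formE !mx2E; lra.
  have kE : k = - \det (v t).
    have := da0 t; rewrite a00 a11 a01 a10 det_mx2 => h.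
    have {}h : 2 * (k * (c t 0 0 * c t 1 1 - c t 0 1 * c t 1 0) +
      (v t 0 0 * v t 1 1 - v t 0 1 * v t 1 0)) = 0 by rewrite -h; ring.
    by move: h; rewrite det1 mulr1 => h; lra.
  by rewrite -kE; apply: matrix2P; rewrite scalemx2E.
(* As a = k c, the derivative of det v is k times that of det c, which is zero by [dv0]. *)
have dvcst t : \det (v t) = \det (v 0).
  apply: (@is_derive_0_is_cst _ (fun t => \det (v t))) => u.
  rewrite (_ : (fun t => \det (v t)) =
    (fun t => v t 0 0 * v t 1 1 - v t 0 1 * v t 1 0)); last first.
    by apply/funext => w; rewrite det_mx2.
  have h := is_deriveB_fun (is_deriveM_fun (va u 0 0) (va u 1 1))
    (is_deriveM_fun (va u 0 1) (va u 1 0)).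
  apply: (is_derive_eq h); rewrite aE !scalemx2E.
  by rewrite -[RHS](mulr0 (- \det (v u))) -(dv0 u); ring.
pose s := Num.sqrt (- \det (v 0)).
have s0 : 0 < s by rewrite sqrtr_gt0; exact: sp.
have s2 : s ^+ 2 = - \det (v 0) by rewrite sqr_sqrtr// ltW//; exact: sp.
exists s, (2^-1 *: (sl_val (c 0) + s^-1 *: v 0)),
  (2^-1 *: (sl_val (c 0) - s^-1 *: v 0)).
split=> // t; apply/matrixP => i j; rewrite !mxE.
have dvij (u : R) : is_derive u 1 (fun t => v t i j) (s ^+ 2 * sl_val (c u) i j).
  by apply: (is_derive_eq (va u i j)); rewrite aE scalemx2E dvcst s2.
rewrite [LHS](ode_hyperbolic (lt0r_neq0 s0) (fun t => xv t i j) dvij).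
by field; rewrite gt_eqF.
Qed.

End Geodesics.

(** * Uniqueness of the axis *)

Section Axis.
Context {R : realType}.
Implicit Types (A P Q M N U W : 'M[R]_2) (s t l m : R) (c : R -> SL2 R).

Lemma cvg_expRN_scale s : 0 < s -> expR (- (s * t)) @[t --> +oo] --> (0 : R).
Proof.
move=> s0; apply: (cvg_comp _ _ _ (@cvgr_expR R)).
by apply: gt0_cvgMry => //; exact: cvg_id.
Qed.

Lemma cornerfrac1 P Q M : \det P = 1 -> \det Q = 1 -> M != 0 ->
  cornerfrac P Q M = 1 -> exists k, M = k *: unchart P Q E00.
Proof.
move=> dP dQ M0; rewrite /cornerfrac; set N := chart P Q M => h.
have N0 : sqnorm N != 0 by rewrite gt_eqF// sqnorm_gt0// chart_neq0.
have {}h : N 0 0 ^+ 2 = sqnorm N by rewrite -[RHS]mul1r -h divfK.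
exists (N 0 0); rewrite -unchartZ -[LHS](chartK dP dQ) -/N; congr unchart.
have z (x y w : R) : x ^+ 2 + y ^+ 2 + w ^+ 2 = 0 -> x = 0.
  move=> e; apply/eqP; rewrite -sqrf_eq0 eq_le sqr_ge0 andbT.
  by have := sqr_ge0 y; have := sqr_ge0 w; lra.
clearbody N.
apply: matrix2P; rewrite scalemx2E mx2E ?mulr1 ?mulr0 //; move: h; rewrite /sqnorm => h.
- by apply: (z _ (N 1 0) (N 1 1)); lra.
- by apply: (z _ (N 0 1) (N 1 1)); lra.
- by apply: (z _ (N 0 1) (N 1 0)); lra.
Qed.

Lemma corner_sl_proj P Q (A : SL2 R) :
  corner P Q (sl_proj A) = cornerfrac P Q (sl_val A).
Proof. by rewrite /sl_proj corner_pi. Qed.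

(** Rescaling by e^(-st) leaves [cornerfrac] unchanged and makes the matrix converge to [U], which
    therefore has [cornerfrac] 1. *)
Lemma leading_term P Q U W s c p : \det P = 1 -> \det Q = 1 -> 0 < s ->
  (forall t, sl_val (c t) = expR (s * t) *: U + expR (- (s * t)) *: W) ->
  sl_proj (c t) @[t --> +oo] --> p -> corner P Q p = 1 ->
  exists k, U = k *: unchart P Q E00.
Proof.
move=> dP dQ s0 cE cp cp1.
(* Otherwise det c(t) = e^(-2st) det W, which is not constantly 1. *)
have U0 : U != 0.
  apply/eqP => U0; have d1 t : expR (- (s * t)) ^+ 2 * \det W = 1.
    by rewrite -detZ -[RHS](sl_det (c t)) cE U0 scaler0 add0r.
  have := d1 0; rewrite mulr0 oppr0 expR0 expr1n mul1r => dW.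
  have := d1 1; rewrite dW !mulr1 => /eqP.
  rewrite -expRM_natr => /eqP h.
  have := expR_lt1 (- s * 2); rewrite h ltxx => /esym; lra.
apply: cornerfrac1 => //.
have c1 : cornerfrac P Q (sl_val (c t)) @[t --> +oo] --> (1 : R).
  rewrite -cp1; under eq_fun do rewrite -corner_sl_proj.
  exact: (cvg_comp _ _ cp (@corner_continuous _ P Q dP dQ p)).
have cU : U + expR (- (2 * s * t)) *: W @[t --> +oo] --> U.
  rewrite -[X in _ --> X]addr0; apply: cvgD; first exact: cvg_cst.
  rewrite -[X in _ --> X](scale0r W).
  apply: cvgZr_tmp; apply: cvg_expRN_scale.
  by rewrite mulr_gt0.
have cfU : cornerfrac P Q (sl_val (c t)) @[t --> +oo] --> cornerfrac P Q U.
  rewrite (_ : (fun t => cornerfrac P Q (sl_val (c t))) =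
    (fun t => cornerfrac P Q (U + expR (- (2 * s * t)) *: W))); last first.
    apply/funext => t; rewrite -(@cornerfracZ _ P Q (expR (- (s * t)))); last first.
      by rewrite gt_eqF ?expR_gt0.
    congr cornerfrac; rewrite cE scalerDr !scalerA -!expRD addNr expR0 scale1r.
    by congr (_ + expR _ *: _); ring.
  exact: cvg_cornerfrac.
exact: (cvg_unique _ cfU c1).
Qed.

Lemma det_unchart_Dmx P Q t : \det P = 1 -> \det Q = 1 ->
  \det (unchart P Q (Dmx t)) == 1.
Proof. by move=> dP dQ; rewrite det_unchart// det_Dmx. Qed.

Definition axis_curve P Q (dP : \det P = 1) (dQ : \det Q = 1) t : SL2 R :=
  MkSL2 (det_unchart_Dmx t dP dQ).

Lemma rot90_E00 P Q : \det P = 1 -> \det Q = 1 ->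
  unchart (P *m rot90) (Q *m rot90) E00 = unchart P Q (mx2 0 0 0 1).
Proof.
move=> dP dQ.
have uJ : (rot90 : 'M[R]_2) \in unitmx by exact: unitmx_det1 det_rot90.
have iJ : invmx (rot90 : 'M[R]_2) = mx2 0 1 (-1) 0.
  apply: (can_inj (mulKmx uJ)); rewrite mulmxV//.
  by apply: matrix2P; rewrite !mulmx2E !mx2E mxE /=; ring.
have uQ := unitmx_det1 dQ.
have iQJ : invmx (Q *m rot90) = invmx rot90 *m invmx Q.
  have uQJ : Q *m rot90 \in unitmx by rewrite unitmx_mul uQ uJ.
  apply: (can_inj (mulKmx uQJ)); rewrite mulmxV// !mulmxA mulmxK//.
  by rewrite mulmxV.
rewrite /unchart iQJ iJ !mulmxA; congr (_ *m _).
rewrite -!mulmxA; congr (_ *m _).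
by apply: matrix2P; rewrite !mulmx2E !mx2E; ring.
Qed.

Lemma det_mul_rot90 P : \det P = 1 -> \det (P *m rot90) = 1.
Proof. by move=> dP; rewrite det_mulmx dP det_rot90 mulr1. Qed.

Lemma spacelike_geodesic_join P Q (dP : \det P = 1) (dQ : \det Q = 1) c p q :
  geodesic c -> spacelike c -> joins c p q ->
  corner (P *m rot90) (Q *m rot90) p = 1 -> corner P Q q = 1 ->
  exists s r e, [/\ 0 < s, e = 1 \/ e = -1 &
    forall t, sl_val (c t) = e *: sl_val (axis_curve dP dQ (s * t + r))].
Proof.
move=> gc sc [cp cq] p1 q1.
have [s [U [W [s0 cE]]]] := spacelike_geodesicE gc sc.
have [u uE] := leading_term dP dQ s0 cE cq q1.
(* Reversing time exchanges [U] and [W], so the limit at -oo is treated by the same lemma in the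
   rotated frames. *)
have cE' t : sl_val (c (- t)) = expR (s * t) *: W + expR (- (s * t)) *: U.
  by rewrite cE mulrN opprK addrC.
have [w wE] : exists k, W = k *: unchart (P *m rot90) (Q *m rot90) E00.
  have cp' := (@cvgNy_compNP (@Defs.proj R) R (fun t => sl_proj (c t)) (nbhs p)).1 cp.
  exact: (@leading_term _ _ _ _ _ (fun t => c (- t)) _
    (det_mul_rot90 dP) (det_mul_rot90 dQ) s0 cE' cp' p1).
have {}cE t : sl_val (c t) =
    unchart P Q (mx2 (u * expR (s * t)) 0 0 (w * expR (- (s * t)))).
  rewrite cE uE wE rot90_E00// !scalerA -!unchartZ /unchart -mulmxDl -mulmxDr.
  congr (_ *m _ *m _); apply: matrix2P; rewrite mxE !scalemx2E !mx2E; ring.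
have uw : u * w = 1.
  have := sl_det (c 0); rewrite cE det_unchart// det_mx2 !mx2E.
  by rewrite mulr0 oppr0 expR0 !mulr1 mulr0 subr0.
have u0 : u != 0 by apply: contra_eq_neq uw => ->; rewrite mul0r eq_sym oner_neq0.
have wE' : w = u^-1 by rewrite -[w]mul1r -(mulVf u0) -mulrA uw mulr1.
(* In the chart c is diagonal with entries u e^(st) and u^-1 e^(-st): |u| shifts the parameter and
   the sign of u factors out. *)
exists s, (ln `|u|), (Num.sg u); split=> //.
  by case: (sgrP u) u0 => // _ _; [left|right].
move=> t; rewrite cE /= -unchartZ; congr unchart.
have E1 : expR (ln `|u|) = `|u| by rewrite lnK// posrE normr_gt0.
have E2 : expR (- ln `|u|) = `|u|^-1 by rewrite expRN E1.
have nu0 : `|u| != 0 by rewrite normr_eq0.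
have sg0 : Num.sg u != 0 by rewrite sgr_eq0.
have sg2 : Num.sg u * Num.sg u = 1 by rewrite -expr2 sqr_sg u0.
have su : u = Num.sg u * `|u| by exact: numEsg.
apply: matrix2P; rewrite scalemx2E !mx2E !DmxE ?mulr0// ?opprD expRD ?E1 ?E2.
- by rewrite [u in LHS]su; ring.
- rewrite wE' [u in LHS]su invfM -[(Num.sg u)^-1]mulr1 -sg2 mulKf//.
  by ring.
Qed.

Variables (g1 g2 : PSL2 R) (P Q : 'M[R]_2) (l m : R).
Hypotheses (l0 : 0 < l) (m0 : 0 < m).
Hypotheses (dgP : diagonalizes g1 P l) (dgQ : diagonalizes g2 Q (- m)).

Let dP : \det P = 1 := dgP.1.
Let dQ : \det Q = 1 := dgQ.1.

Definition axis_line : set (@AdS R) :=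
  range (fun t => \pi_(PSL2 R) (axis_curve dP dQ t)).

(** A repelling point attracts under the inverse pair, whose exponents are again [l] and [- m] in
    the rotated frames, so [attracting_corner] applies at both ends. The geodesic is then an affine
    reparametrisation of [axis_curve] up to sign, with the same range. *)
Lemma is_axis_unique L : is_axis (g1, g2) L -> L = axis_line.
Proof.
move=> [p [q [c [rp aq [gc sc] cpq ->]]]].
have dgP' := diagonalizes_rot90 (diagonalizes_inv dgP).
have dgQ' := diagonalizes_rot90 (diagonalizes_inv dgQ).
rewrite opprK in dgP'; rewrite opprK in dgQ'.
have q1 := attracting_corner l0 m0 dgP dgQ aq.
have p1 := attracting_corner l0 m0 dgP' dgQ' rp.
have [s [r [e [s0 e1 cE]]]] := spacelike_geodesic_join dP dQ gc sc cpq p1 q1.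
have piE t : \pi_(PSL2 R) (c t) = \pi_(PSL2 R) (axis_curve dP dQ (s * t + r)).
  apply/eqP/psl_eqP; rewrite cE.
  by case: e1 => ->; rewrite ?scale1r ?scaleN1r; [left|right].
apply/seteqP; split=> [_ [t _ <-]|_ [t _ <-]].
  by exists (s * t + r).
exists ((t - r) / s) => //; rewrite piE; congr (\pi_(PSL2 R) (axis_curve _ _ _)).
by rewrite mulrC divfK ?gt_eqF// subrK.
Qed.
End Axis.

(** * Existence of the axis and the translation along it *)

Section Axis_curve.
Context {R : realType}.
Implicit Types (A B P Q M N V W : 'M[R]_2) (s t k r : R) (c : R -> SL2 R).

Lemma is_derive_mulmx2 A B (X X' : R -> 'M[R]_2) t :
  (forall i j, is_derive t 1 (fun s => X s i j) (X' t i j)) ->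
  forall i j, is_derive t 1 (fun s => (A *m X s *m B) i j) ((A *m X' t *m B) i j).
Proof.
move=> h i j.
have E M : (A *m M *m B) i j = (A i 0 * M 0 0 + A i 1 * M 1 0) * B 0 j +
    (A i 0 * M 0 1 + A i 1 * M 1 1) * B 1 j by rewrite !mulmx2E.
rewrite (_ : (fun s => (A *m X s *m B) i j) = (fun s =>
    (A i 0 * X s 0 0 + A i 1 * X s 1 0) * B 0 j +
    (A i 0 * X s 0 1 + A i 1 * X s 1 1) * B 1 j)); last first.
  by apply/funext => s; rewrite E.
have cM (a : R) p q := is_deriveM_fun (is_derive_cst a t 1) (h p q).
have row q := is_deriveD_fun (cM (A i 0) 0 q) (cM (A i 1) 1 q).
have d := is_deriveD_fun (is_deriveM_fun (row 0) (is_derive_cst (B 0 j) t 1))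
                         (is_deriveM_fun (row 1) (is_derive_cst (B 1 j) t 1)).
by apply: (is_derive_eq d); rewrite E /cst; ring.
Qed.

Definition dDmx t : 'M[R]_2 := mx2 (expR t) 0 0 (- expR (- t)).

Lemma is_derive_Dmx k r t i j :
  is_derive t 1 (fun s => Dmx (k * s + r) i j) ((k *: dDmx (k * t + r)) i j).
Proof.
have e1 := is_derive_expR_lin k r t.
have e2 := is_derive_expR_lin (- k) (- r) t.
have D00 : (fun s => Dmx (k * s + r) 0 0) = (fun s => expR (k * s + r)).
  by apply/funext => s; rewrite DmxE.
have D11 : (fun s => Dmx (k * s + r) 1 1) = (fun s => expR (- k * s + - r)).
  by apply/funext => s; rewrite DmxE opprD mulNr.
have D01 : (fun s => Dmx (k * s + r) 0 1) = cst 0 by apply/funext => s; rewrite DmxE.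
have D10 : (fun s => Dmx (k * s + r) 1 0) = cst 0 by apply/funext => s; rewrite DmxE.
rewrite scalemx2E; case: (ord2P i) => ->; case: (ord2P j) => ->; rewrite mx2E.
- by rewrite D00.
- by rewrite D01 mulr0; exact: is_derive_cst.
- by rewrite D10 mulr0; exact: is_derive_cst.
- rewrite D11; apply: (is_derive_eq e2).
  by rewrite (_ : - (k * t + r) = - k * t + - r); ring.
Qed.

Lemma is_derive_dDmx k r t i j :
  is_derive t 1 (fun s => (k *: dDmx (k * s + r)) i j)
    ((k ^+ 2 *: Dmx (k * t + r)) i j).
Proof.
have e1 := is_derive_expR_lin k r t.
have e2 := is_derive_expR_lin (- k) (- r) t.
have kc := is_derive_cst k t 1.
have D00 : (fun s => (k *: dDmx (k * s + r)) 0 0) = (fun s => k * expR (k * s + r)).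
  by apply/funext => s; rewrite scalemx2E mx2E.
have D11 : (fun s => (k *: dDmx (k * s + r)) 1 1) =
    (fun s => - k * expR (- k * s + - r)).
  by apply/funext => s; rewrite scalemx2E mx2E opprD !mulNr mulrN.
have D01 : (fun s => (k *: dDmx (k * s + r)) 0 1) = cst 0.
  by apply/funext => s; rewrite scalemx2E mx2E mulr0.
have D10 : (fun s => (k *: dDmx (k * s + r)) 1 0) = cst 0.
  by apply/funext => s; rewrite scalemx2E mx2E mulr0.
rewrite scalemx2E; case: (ord2P i) => ->; case: (ord2P j) => ->; rewrite DmxE.
- by rewrite D00; apply: (is_derive_eq (is_deriveM_fun kc e1)); rewrite /cst; ring.
- by rewrite D01 mulr0; exact: is_derive_cst.
- by rewrite D10 mulr0; exact: is_derive_cst.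
- rewrite D11; apply: (is_derive_eq (is_deriveM_fun (is_derive_cst (- k) t 1) e2)).
  by rewrite /cst (_ : - (k * t + r) = - k * t + - r); ring.
Qed.

Lemma derivable_mx_continuous (X : R -> 'M[R]_2) :
  (forall t, derivable X t 1) -> continuous X.
Proof.
by move=> dX t; apply/differentiable_continuous/derivable1_diffP; exact: dX.
Qed.

Section Curve.
Variables (P Q : 'M[R]_2).
Hypotheses (dP : \det P = 1) (dQ : \det Q = 1).

(** The affine parameter k s + r serves both the unit-speed geodesic (k = 1, r = 0) and the paths
    over [0, 1] of length k. *)
Lemma derive_axis_curve k r t :
  derivable (fun s => sl_val (axis_curve dP dQ (k * s + r))) t 1 /\
  velocity (fun s => axis_curve dP dQ (k * s + r)) t =
    unchart P Q (k *: dDmx (k * t + r)).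
Proof.
exact: (@is_derive_entries _ (fun s => unchart P Q (Dmx (k * s + r)))
  (fun s => unchart P Q (k *: dDmx (k * s + r))) t
  (is_derive_mulmx2 (X' := fun s => k *: dDmx (k * s + r)) P (invmx Q)
    (is_derive_Dmx k r t))).
Qed.

Lemma derive_velocity_axis_curve k r t :
  derivable (velocity (fun s => axis_curve dP dQ (k * s + r))) t 1 /\
  derive1 (velocity (fun s => axis_curve dP dQ (k * s + r))) t =
    k ^+ 2 *: sl_val (axis_curve dP dQ (k * t + r)).
Proof.
have -> : velocity (fun s => axis_curve dP dQ (k * s + r)) =
    fun s => unchart P Q (k *: dDmx (k * s + r)).
  by apply/funext => s; exact: (derive_axis_curve k r s).2.
rewrite /= -unchartZ.
exact: (@is_derive_entries _ (fun s => unchart P Q (k *: dDmx (k * s + r)))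
  (fun s => unchart P Q (k ^+ 2 *: Dmx (k * s + r))) t
  (is_derive_mulmx2 (X' := fun s => k ^+ 2 *: Dmx (k * s + r)) P (invmx Q)
    (is_derive_dDmx k r t))).
Qed.

Lemma det_velocity_axis_curve k r t :
  \det (velocity (fun s => axis_curve dP dQ (k * s + r)) t) = - k ^+ 2.
Proof.
rewrite (derive_axis_curve k r t).2 det_unchart// detZ det_mx2 !mx2E.
by rewrite mulr0 subr0 mulrN -expRD subrr expR0 mulrN1.
Qed.

Lemma axis_curve_eq1 : axis_curve dP dQ = fun s => axis_curve dP dQ (1 * s + 0).
Proof. by apply/funext => s; rewrite mul1r addr0. Qed.

Lemma geodesic_axis_curve : geodesic (axis_curve dP dQ).
Proof.
rewrite axis_curve_eq1; split=> [t|t|t V h].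
- exact: (derive_axis_curve 1 0 t).1.
- exact: (derive_velocity_axis_curve 1 0 t).1.
- by rewrite (derive_velocity_axis_curve 1 0 t).2 expr1n scale1r.
Qed.

Lemma spacelike_axis_curve : spacelike (axis_curve dP dQ).
Proof.
by move=> t; rewrite axis_curve_eq1 det_velocity_axis_curve opprK expr1n ltr01.
Qed.

Lemma C1_axis_curve k r : C1 (fun s => sl_val (axis_curve dP dQ (k * s + r))).
Proof.
split=> [t|]; first exact: (derive_axis_curve k r t).1.
by apply: derivable_mx_continuous => t; exact: (derive_velocity_axis_curve k r t).1.
Qed.

Lemma ads_length_axis_curve k r : 0 <= k ->
  ads_length (fun s => axis_curve dP dQ (k * s + r)) = k.
Proof.
move=> k0; apply: Rintegral01_cst => t _.
by rewrite det_velocity_axis_curve opprK sqrtr_sqr ger0_norm.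
Qed.

Lemma joins_axis_curve :
  joins (axis_curve dP dQ)
    (\pi_(@Defs.proj R)
      (mknz (unchart_E00_neq0 (det_mul_rot90 dP) (det_mul_rot90 dQ))))
    (\pi_(@Defs.proj R) (mknz (unchart_E00_neq0 dP dQ))).
Proof.
have e0 t : expR (- t) != 0 by rewrite gt_eqF ?expR_gt0.
have c2 : expR (- (2 * t)) @[t --> +oo] --> (0 : R) by exact: cvg_expRN_scale.
split; last first.
  apply: (@cvg_pi_proj_scale _ _ _ _ _ (fun t => expR (- t))) => //.
  rewrite (_ : (fun t => _) =
    (fun t => unchart P Q (mx2 1 0 0 (expR (- (2 * t)))))); last first.
    apply/funext => t /=; rewrite -unchartZ; congr unchart.
    apply: matrix2P; rewrite scalemx2E mx2E DmxE ?mulr0// -expRD.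
      by rewrite addNr expR0.
    by congr expR; ring.
  apply: cvg_unchart; apply: cvg_entries; under eq_fun do rewrite mx2E; rewrite mx2E//;
    exact: cvg_cst.
(* The end at -oo is reached by reversing time; the same rescaling now leaves E11, that is, E00 in
   the rotated frames. *)
pose f (t : R) := sl_proj (axis_curve dP dQ t).
apply: (@cvgNy_compNP (@Defs.proj R) R f _).2.
apply: (@cvg_pi_proj_scale _ _ _ _ _ (fun t => expR (- t))) => //.
rewrite (_ : (fun t => _) =
    (fun t => unchart P Q (mx2 (expR (- (2 * t))) 0 0 1))); last first.
  apply/funext => t /=; rewrite -unchartZ; congr unchart.
  apply: matrix2P; rewrite scalemx2E mx2E DmxE ?mulr0// -expRD.
    by congr expR; ring.
  by rewrite opprK addNr expR0.
rewrite [set_val _](rot90_E00 dP dQ).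
apply: cvg_unchart; apply: cvg_entries; under eq_fun do rewrite mx2E; rewrite mx2E//;
  exact: cvg_cst.
Qed.

End Curve.

Lemma ads_act_pi (g1 g2 : PSL2 R) (A : SL2 R) :
  ads_act (g1, g2) (\pi_(PSL2 R) A) =
  \pi_(PSL2 R) (sl_mul (sl_mul (repr g1) A) (sl_inv (repr g2))).
Proof.
rewrite -[LHS]/(psl_mul (psl_mul g1 (\pi_(PSL2 R) A)) (psl_inv g2)).
have g1A : psl_mul g1 (\pi_(PSL2 R) A) = \pi_(PSL2 R) (sl_mul (repr g1) A).
  by have := Defs.pi_mul (repr g1) A; rewrite [X in psl_mul X _](reprK g1).
by rewrite g1A; exact: Defs.pi_mul.
Qed.

Section Pair.
Variables (g1 g2 : PSL2 R) (P Q : 'M[R]_2) (l m : R).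
Hypotheses (l0 : 0 < l) (m0 : 0 < m).
Hypotheses (dgP : diagonalizes g1 P l) (dgQ : diagonalizes g2 Q (- m)).

Lemma is_axis_axis_line : is_axis (g1, g2) (axis_line dgP dgQ).
Proof.
have dgP' := diagonalizes_rot90 (diagonalizes_inv dgP).
have dgQ' := diagonalizes_rot90 (diagonalizes_inv dgQ).
rewrite opprK in dgP'; rewrite opprK in dgQ'.
exists (\pi_(@Defs.proj R) (mknz (unchart_E00_neq0 dgP'.1 dgQ'.1))),
  (\pi_(@Defs.proj R) (mknz (unchart_E00_neq0 dgP.1 dgQ.1))),
  (axis_curve dgP.1 dgQ.1); split=> //.
- exact: (attracting_pt l0 m0 dgP' dgQ').
- exact: (attracting_pt l0 m0 dgP dgQ).
- by split; [exact: geodesic_axis_curve|exact: spacelike_axis_curve].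
- have [h1 h2] := joins_axis_curve dgP.1 dgQ.1; split=> //.
  move: h1; rewrite (_ : mknz _ = mknz (unchart_E00_neq0 dgP'.1 dgQ'.1))//.
  exact: val_inj.
Qed.

(** Existence makes the choice by [get] satisfy [is_axis], and uniqueness identifies it. *)
Lemma axisE : axis (g1, g2) = axis_line dgP dgQ.
Proof.
apply: is_axis_unique => //.
exact: (@getPex _ (is_axis (g1, g2)) (ex_intro _ _ is_axis_axis_line)).
Qed.

Lemma ads_act_axis t :
  ads_act (g1, g2) (\pi_(PSL2 R) (axis_curve dgP.1 dgQ.1 t)) =
  \pi_(PSL2 R) (axis_curve dgP.1 dgQ.1 (t + (l + m))).
Proof.
have [e e0 actE] := chart_act dgP dgQ.
set X := sl_mul (sl_mul (repr g1) (axis_curve dgP.1 dgQ.1 t)) (sl_inv (repr g2)).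
have -> : ads_act (g1, g2) (\pi_(PSL2 R) (axis_curve dgP.1 dgQ.1 t)) = \pi_(PSL2 R) X.
  exact: ads_act_pi.
have XE : sl_val X = e *: sl_val (axis_curve dgP.1 dgQ.1 (t + (l + m))).
  rewrite -[LHS](chartK dgP.1 dgQ.1) [sl_val X]/= actE /= unchartK ?dgP.1 ?dgQ.1//.
  rewrite unchartZ; congr (_ *: unchart _ _ _).
  by rewrite -!DmxD; congr Dmx; ring.
(* Both matrices have determinant 1, so e^2 = 1 and they agree in [PSL2]. *)
have /eqP := sl_det X.
rewrite XE detZ sl_det mulr1 sqrf_eq1 => /orP[]/eqP e1.
  by apply/eqP/psl_eqP; left; rewrite XE e1 scale1r.
by apply/eqP/psl_eqP; right; rewrite XE e1 scaleN1r.
Qed.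

End Pair.
End Axis_curve.

(** * Translation length on the axis *)

Section Induced_distance.
Context {R : realType}.
Implicit Types (P Q M N : 'M[R]_2) (s t k r : R) (c : R -> SL2 R).

Lemma is_derive_cst_itv (f : R -> R) t r d (a b : R) : t \in `]a, b[ ->
  (forall s, s \in `]a, b[ -> f s = r) -> is_derive t 1 f d -> d = 0.
Proof.
move=> tab fr df.
have fn : \near t, f t = cst r t.
  have : \forall s \near t, s \in `]a, b[ by exact: near_in_itvoo.
  by apply: filterS => s /fr.
have h := near_eq_is_derive fn df.
by rewrite -(@derive_val _ _ _ _ _ _ _ h) derive_cst.
Qed.

Section Path.
Variables (g1 g2 : PSL2 R) (P Q : 'M[R]_2) (l m : R).
Hypotheses (dgP : diagonalizes g1 P l) (dgQ : diagonalizes g2 Q (- m)).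

Let dP : \det P = 1 := dgP.1.
Let dQ : \det Q = 1 := dgQ.1.

(** A path on the axis equals +-P D_u Q^-1 with no regularity known for u or for the sign. The
    coordinate is recovered as ln (N00^2) / 2, which is insensitive to the sign and differentiable
    along the path. *)
Lemma ads_path_length_ge t r c :
  ads_path (axis_line dgP dgQ) (\pi_(PSL2 R) (axis_curve dP dQ t))
    (\pi_(PSL2 R) (axis_curve dP dQ r)) c -> r - t <= ads_length c.
Proof.
move=> [[dc cv] cL c0 c1].
have chartE (A : SL2 R) s : \pi_(PSL2 R) A = \pi_(PSL2 R) (axis_curve dP dQ s) ->
    exists2 e : R, e ^+ 2 = 1 & chart P Q (sl_val A) = e *: Dmx s.
  move=> /eqP/psl_eqP[] ->; [exists 1|exists (-1)]; rewrite ?sqrrN ?expr1n//=.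
    by rewrite scale1r unchartK.
  by rewrite -scaleN1r chartZ unchartK.
pose N s := chart P Q (sl_val (c s)).
pose N' s := chart P Q (velocity c s).
have dN (s : R) i j : is_derive s 1 (fun u => N u i j) (N' s i j).
  by apply: (@is_derive_mulmx2 _ _ _ (fun u => sl_val (c u)) (velocity c)) => p q;
    exact: is_derive_entry.
have cN' (s : R) i j : {for s, continuous (fun u => N' u i j)}.
  have h : velocity c u @[u --> s] --> velocity c s by exact: cv.
  exact: (cvg_coord (cvg_chart h)).
have cN (s : R) i j : {for s, continuous (fun u => N u i j)}.
  exact: is_derive_continuous (dN s i j).
have diagN s : s \in `[0, 1] -> [/\ N s 0 1 = 0, N s 1 0 = 0 & N s 0 0 * N s 1 1 = 1].
  move=> /cL [u _ /esym cu]; have [e e2 NE] := chartE _ _ cu.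
  rewrite /N NE !scalemx2E !DmxE !mulr0; split=> //.
  by rewrite mulrACA -expr2 e2 mul1r -expRD subrr expR0.
have N00 s : s \in `[0, 1] -> N s 0 0 != 0.
  by move=> /diagN [_ _ h]; apply: contra_eq_neq h => ->; rewrite mul0r eq_sym oner_neq0.
have NN s : s \in `[0, 1] -> 0 < N s 0 0 * N s 0 0.
  by move=> /N00 h; rewrite -expr2 exprn_even_gt0.
have end0 u s : \pi_(PSL2 R) (c u) = \pi_(PSL2 R) (axis_curve dP dQ s) ->
    ln (N u 0 0 * N u 0 0) / 2 = s.
  move=> /chartE [e e2 NE]; rewrite /N NE scalemx2E DmxE mulrACA -expr2 e2 mul1r.
  by rewrite -expRD expRK; field.
rewrite -(end0 _ _ c0) -(end0 _ _ c1).
apply: (@le_Rintegral_deriv R (fun s => ln (N s 0 0 * N s 0 0) / 2)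
  (fun s => N' s 0 0 / N s 0 0)) => //.
- move=> s s01.
  have h := is_deriveM_fun
    (@is_derive_ln_fun _ (fun s => N s 0 0 * N s 0 0) _ _ (NN s s01)
      (is_deriveM_fun (dN s 0 0) (dN s 0 0))) (is_derive_cst (2^-1 : R) s 1).
  by apply: (is_derive_eq h); rewrite /cst; field; exact: N00.
- by move=> s s01; apply: continuousM => //; apply: continuousV => //; exact: N00.
- move=> s _; apply: (@continuous_comp _ _ _ (fun s => - \det (velocity c s)) (@Num.sqrt R)).
    apply: continuousN; apply: cvg_det2; exact: cv.
  exact: sqrt_continuous.
- move=> s s01; have s01' := subset_itv_oo_cc s01.
  have z01 : N' s 0 1 = 0.
    apply: (is_derive_cst_itv (r := 0) s01 _ (dN s 0 1)) => u /subset_itv_oo_cc u01.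
    by have [] := diagN u u01.
  have z11 : N' s 0 0 * N s 1 1 + N s 0 0 * N' s 1 1 = 0.
    apply: (is_derive_cst_itv (r := 1) s01 _ (is_deriveM_fun (dN s 0 0) (dN s 1 1))) => u.
    by move=> /subset_itv_oo_cc u01; have [] := diagN u u01.
  have [_ _ n1] := diagN s s01'; have n0 := N00 s s01'.
  (* Since N01' = 0 and N11 = 1 / N00, the determinant of N' is - (N00' / N00)^2: the speed is |N00'
     / N00|. *)
  have -> : - \det (velocity c s) = (N' s 0 0 / N s 0 0) ^+ 2.
    rewrite -(@det_chart _ P Q) // -/(N' s) det_mx2 z01 mul0r subr0.
    have N11 : N s 1 1 = (N s 0 0)^-1 by rewrite -[RHS]mulr1 -n1 mulKf.
    have -> : N' s 1 1 = - (N' s 0 0 / N s 0 0 ^+ 2).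
      apply: (mulfI n0); transitivity (- (N' s 0 0 * N s 1 1)).
        by apply/eqP; rewrite -addr_eq0 addrC z11.
      by rewrite N11; field.
    by field.
  by rewrite sqrtr_sqr ler_norm.
Qed.

Lemma ads_path_axis_curve t k : 0 <= k ->
  ads_path (axis_line dgP dgQ) (\pi_(PSL2 R) (axis_curve dP dQ t))
    (\pi_(PSL2 R) (axis_curve dP dQ (t + k))) (fun s => axis_curve dP dQ (k * s + t)).
Proof.
move=> k0; split.
- exact: C1_axis_curve.
- by move=> s _; exists (k * s + t).
- by rewrite mulr0 add0r.
- by rewrite mulr1 addrC.
Qed.

Lemma induced_dist_axis t k : 0 <= k ->
  induced_dist (axis_line dgP dgQ) (\pi_(PSL2 R) (axis_curve dP dQ t))
    (\pi_(PSL2 R) (axis_curve dP dQ (t + k))) = k.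
Proof.
move=> k0; have path := ads_path_axis_curve t k0.
have lb : lbound (ads_length @` ads_path (axis_line dgP dgQ)
    (\pi_(PSL2 R) (axis_curve dP dQ t)) (\pi_(PSL2 R) (axis_curve dP dQ (t + k)))) k.
  move=> _ [c cp <-]; have := ads_path_length_ge cp.
  by rewrite addrAC subrr add0r.
apply/eqP; rewrite eq_le; apply/andP; split; last first.
  apply: lb_le_inf => //.
  exists (ads_length (fun s => axis_curve dP dQ (k * s + t))).
  by exists (fun s => axis_curve dP dQ (k * s + t)).
apply: ge_inf; first by exists k.
exists (fun s => axis_curve dP dQ (k * s + t)) => //.
exact: ads_length_axis_curve.
Qed.

Lemma lorentz_translation_lengthE : 0 < l -> 0 < m ->
  lorentz_translation_length (g1, g2) = l + m.
Proof.
move=> l0 m0; have lm : 0 <= l + m by rewrite addr_ge0// ltW.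
rewrite /lorentz_translation_length (axisE l0 m0 dgP dgQ).
have disp o : axis_line dgP dgQ o ->
    induced_dist (axis_line dgP dgQ) o (ads_act (g1, g2) o) = l + m.
  by move=> [t _ <-]; rewrite ads_act_axis induced_dist_axis.
have ex : axis_line dgP dgQ (\pi_(PSL2 R) (axis_curve dP dQ 0)) by exists 0.
set S := (X in get X);
have Slm : S (l + m).
  by split=> //; exists (\pi_(PSL2 R) (axis_curve dP dQ 0)).
(* The chosen value is only known to lie in [S]; evaluating at a point of the nonempty axis
   determines it. *)
have [_ h] : S (get S) := getPex (ex_intro _ _ Slm).
by rewrite -(h _ ex) disp.
Qed.

End Path.

End Induced_distance.

Theorem proposition2p3 (R : realType) (g1 g2 : PSL2 R)
    (hyp1 : hyperbolic g1) (hyp2 : hyperbolic g2) :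
  lorentz_translation_length (g1, g2) =
    (hyp_translation_length g1 + hyp_translation_length g2) / 2.
Proof.
have [P [l [l0 dgP]]] := hyperbolic_diagonalizes hyp1.
have [Q [m [m0 dgQ]]] := hyperbolic_diagonalizes hyp2.
(* The normal form of the axis wants the second exponent negative, whence the rotated frame; the
   hyperbolic length of [g2] uses the unrotated one. *)
rewrite (lorentz_translation_lengthE dgP (diagonalizes_rot90 dgQ) l0 m0).
rewrite (hyp_translation_lengthE (ltW l0) dgP).
by rewrite (hyp_translation_lengthE (ltW m0) dgQ); field.
Qed.
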